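(* The following decision problem (verification under admissible semantics) is in $\mathsf{P}$: given a finite bipolar ABA framework $\mathcal{F}=(\mathcal{L},\mathcal{R},\mathcal{A},\overline{\phantom{a}})$ and $A\subseteq\mathcal{A}$, is $A$ an admissible extension of $\mathcal{F}$?
   Context: An ABA framework is a tuple $(\mathcal{L},\mathcal{R},\mathcal{A},\overline{\phantom{a}})$ where $\mathcal{L}$ is a set of sentences; $\mathcal{R}$ is a set of rules $\varphi_0\leftarrow\varphi_1,\dots,\varphi_m$ with $m\ge 0$ and all $\varphi_i\in\mathcal{L}$ (head $\varphi_0$, body $\varphi_1,\dots,\varphi_m$; for $m=0$ written $\varphi_0\leftarrow\top$ with $\top\notin\mathcal{L}$); $\mathcal{A}\subseteq\mathcal{L}$ is a non-empty set of assumptions; and $\overline{\phantom{a}}:\mathcal{A}\to\mathcal{L}$ is a total map ($\overline{\alpha}$ is the contrary of $\alpha$). It is bipolar iff every rule is of the form $\varphi\leftarrow\alpha$ with $\alpha\in\mathcal{A}$ and either $\varphi\in\mathcal{A}$ or $\varphi=\overline{\beta}$ for some $\beta\in\mathcal{A}$. A deduction $A\vdash^{R}\varphi$ for $\varphi\in\mathcal{L}$ supported by $A\subseteq\mathcal{A}$ and $R\subseteq\mathcal{R}$ is a finite tree with root labelled $\varphi$; leaves labelled by $\top$ or assumptions, with $A$ the set of all assumptions labelling leaves; and the children of each non-leaf labelled $\psi$ labelled by the elements of the body of some rule in $\mathcal{R}$ with head $\psi$, with $R$ the set of all rules so used. For $A,B\subseteq\mathcal{A}$: $A$ attacks $B$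 if there is a deduction $A'\vdash^{R}\overline{\beta}$ with $\beta\in B$, $A'\subseteq A$, $R\subseteq\mathcal{R}$. $Cl(A)=\{\alpha\in\mathcal{A}:\exists\, A'\vdash^{R}\alpha,\ A'\subseteq A,\ R\subseteq\mathcal{R}\}$; $A$ is closed iff $A=Cl(A)$; $A$ is conflict-free iff $A$ does not attack $A$; $A$ defends $\alpha\in\mathcal{A}$ iff $A$ attacks every closed $B\subseteq\mathcal{A}$ that attacks $\{\alpha\}$; $A$ defends $B$ iff it defends every $\beta\in B$. $A$ is admissible iff it is closed, conflict-free and defends itself. *)

(* Defs.v *)
From HB Require Import structures.
From mathcomp Require Import all_boot all_order all_algebra.

Set Implicit Arguments.
Unset Strict Implicit.
Unset Printing Implicit Defensive.

(* A rule [(h, [:: b1; ..; bm])] stands for [h <- b1, .., bm]. *)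
Definition rule (L : Type) : Type := (L * seq L)%type.

(* The finite set of rules is given by a listing: order and repetitions in
   [rules] are irrelevant to every notion below. *)
Record aba (L : finType) := ABA {
  rules : seq (rule L);
  asm : {set L};
  asm_neq0 : asm != set0;
  contrary : {x : L | x \in asm} -> L
}.

Definition bipolar (L : finType) (F : aba L) : Prop :=
  forall r, r \in rules F ->
    exists2 a, a \in asm F &
      r.2 = [:: a] /\ (r.1 \in asm F \/ exists b, r.1 = contrary (a := F) b).

(* Finite labelled trees; the label [None] is the symbol [top], which is not
   a sentence. *)
Inductive tree (L : Type) := Node of option L & seq (tree L).

Definition label (L : Type) (t : tree L) : option L := let: Node l _ := t in l.

(* A rule with empty body, [h <- top], gives a single child labelled [top]. *)
Definition body_labels (L : Type) (b : seq L) : seq (option L) :=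
  if b is [::] then [:: None] else map Some b.

Fixpoint tree_wf (L : finType) (F : aba L) (t : tree L) : bool :=
  match t with
  | Node None ts => nilp ts
  | Node (Some a) [::] => a \in asm F
  | Node (Some h) ts =>
      has (fun r => (r.1 == h) && (map (@label L) ts == body_labels r.2))
          (rules F)
      && all (tree_wf F) ts
  end.

Fixpoint leaf_asms (L : Type) (t : tree L) : seq L :=
  match t with
  | Node None [::] => [::]
  | Node (Some a) [::] => [:: a]
  | Node _ ts => flatten (map (@leaf_asms L) ts)
  end.

(* In a well-formed tree the rule applied at an inner node is determined by
   the labels of the node and of its children. *)
Fixpoint used_rules (L : Type) (t : tree L) : seq (rule L) :=
  match t with
  | Node (Some h) ((_ :: _) as ts) =>
      (h, pmap (@label L) ts) :: flatten (map (@used_rules L) ts)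
  | _ => [::]
  end.

Definition deduction (L : finType) (F : aba L)
    (A : {set L}) (R : seq (rule L)) (phi : L) : Prop :=
  exists t : tree L,
    [/\ label t = Some phi, tree_wf F t,
        A =i leaf_asms t & R =i used_rules t].

Definition derives (L : finType) (F : aba L) (A : {set L}) (phi : L) : Prop :=
  exists (A' : {set L}) (R : seq (rule L)),
    [/\ A' \subset A, {subset R <= rules F} & deduction F A' R phi].

Definition attacks (L : finType) (F : aba L) (A B : {set L}) : Prop :=
  exists2 b : {x : L | x \in asm F}, val b \in B & derives F A (contrary b).

Definition Cl (L : finType) (F : aba L) (A : {set L}) (a : L) : Prop :=
  a \in asm F /\ derives F A a.

Definition closed (L : finType) (F : aba L) (A : {set L}) : Prop :=
  forall a, a \in A <-> Cl F A a.

Definition conflict_free (L : finType) (F : aba L) (A : {set L}) : Prop :=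
  ~ attacks F A A.

Definition defends (L : finType) (F : aba L) (A : {set L}) (a : L) : Prop :=
  forall B : {set L}, B \subset asm F -> closed F B ->
    attacks F B [set a] -> attacks F A B.

Definition defends_set (L : finType) (F : aba L) (A B : {set L}) : Prop :=
  forall b, b \in B -> defends F A b.

Definition admissible (L : finType) (F : aba L) (A : {set L}) : Prop :=
  [/\ closed F A, conflict_free F A & defends_set F A A].

Inductive direction := MoveL | MoveN | MoveR.

(* [Tape l c r] is a two-way infinite tape: [c] is scanned, [l] and [r] list
   the cells to the left and to the right of the head, nearest first, and all
   further cells are blank ([None]). *)
Inductive tape (G : Type) := Tape of seq (option G) & option G & seq (option G).

Definition scanned (G : Type) (t : tape G) : option G := let: Tape _ c _ := t in c.

Definition write_move (G : Type) (t : tape G) (a : option G * direction) : tape G :=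
  let: Tape l _ r := t in
  match a.2 with
  | MoveL => Tape (behead l) (head None l) (a.1 :: r)
  | MoveN => Tape l a.1 r
  | MoveR => Tape (a.1 :: l) (head None r) (behead r)
  end.

Definition input_tape (G : Type) (w : seq G) : tape G :=
  Tape [::] (ohead w) (map Some (behead w)).

(* A machine with [tm_tapes.+1] tapes. Its tape symbols are the input symbols
   [inl s], the work symbols [inr g], and the blank [None]. A state [q] with
   [tm_verdict q = Some b] is halting, and accepting iff [b]. *)
Record tm (S : finType) := TM {
  tm_tapes : nat;
  tm_state : finType;
  tm_work : finType;
  tm_start : tm_state;
  tm_verdict : tm_state -> option bool;
  tm_trans : tm_state -> {ffun 'I_tm_tapes.+1 -> option (S + tm_work)} ->
    tm_state * {ffun 'I_tm_tapes.+1 -> option (S + tm_work) * direction}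
}.

Record config (S : finType) (M : tm S) := Config {
  cfg_state : tm_state M;
  cfg_tapes : 'I_(tm_tapes M).+1 -> tape (S + tm_work M)
}.

Definition tm_step (S : finType) (M : tm S) (c : config M) : config M :=
  if tm_verdict (cfg_state c) is Some _ then c else
  let: (q, a) := tm_trans (cfg_state c) [ffun i => scanned (cfg_tapes c i)] in
  Config q (fun i => write_move (cfg_tapes c i) (a i)).

Definition tm_init (S : finType) (M : tm S) (w : seq S) : config M :=
  Config (tm_start M)
    (fun i => input_tape (if i == ord0 then map inl w else [::])).

Definition halts_with (S : finType) (M : tm S) (w : seq S) (t : nat) (b : bool) :
    Prop :=
  tm_verdict (cfg_state (iter t (@tm_step S M) (tm_init M w))) = Some b.

Definition in_P (S : finType) (lang : seq S -> Prop) : Prop :=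
  exists (M : tm S) (p : {poly nat}), forall w : seq S,
    exists t b, [/\ t <= p.[size w]%R, halts_with M w t b & b <-> lang w].

Inductive symbol := Tick | SAsm | SContrary | SHead | SBody | SMember.

Definition symbol_code (s : symbol) : 'I_6 :=
  match s with
  | Tick => @Ordinal 6 0 isT | SAsm => @Ordinal 6 1 isT
  | SContrary => @Ordinal 6 2 isT | SHead => @Ordinal 6 3 isT
  | SBody => @Ordinal 6 4 isT | SMember => @Ordinal 6 5 isT
  end.

Definition symbol_decode (i : 'I_6) : symbol :=
  nth Tick [:: Tick; SAsm; SContrary; SHead; SBody; SMember] i.

Lemma symbol_codeK : cancel symbol_code symbol_decode.
Proof. by case. Qed.

HB.instance Definition _ := Finite.copy symbol (can_type symbol_codeK).

(* Sentences are numbered [0 .. #|L| - 1] and numbers are written in unary.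
   As an input lists all of [L], its length is at least [#|L|], so this is
   polynomially equivalent to writing the numbers in binary. *)
Definition unary (n : nat) : seq symbol := nseq n Tick.

Definition encode_item (L : finType) (s : symbol) (x : L) : seq symbol :=
  s :: unary (enum_rank x).

Definition encode_rule (L : finType) (r : rule L) : seq symbol :=
  encode_item SHead r.1 ++ flatten (map (encode_item SBody) r.2).

(* In order: the number of sentences, each assumption with its contrary, the
   rules, and the elements of the candidate extension. *)
Definition encode (L : finType) (F : aba L) (A : {set L}) : seq symbol :=
  unary #|L|
  ++ flatten [seq encode_item SAsm (val a) ++ encode_item SContrary (contrary a)
             | a <- enum {: {x : L | x \in asm F}}]
  ++ flatten (map (@encode_rule L) (rules F))
  ++ flatten (map (encode_item SMember) (enum A)).

Definition bipolar_verification_admissible (w : seq symbol) : Prop :=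
  exists (L : finType) (F : aba L) (A : {set L}),
    [/\ bipolar F, A \subset asm F, w = encode F A & admissible F A].

(* Main.v *)
(* Every rule of a bipolar framework has a single body element, an assumption,
   so derivability is reachability. A closed attacker of [A] contains the closure
   of a single assumption which attacks [A] by at most one rule. Hence a closed,
   conflict-free [A] is admissible iff every assumption [x] directly attacking
   [A] lies in the set [S] of the assumptions from which some assumption attacked
   by [A] can be reached, and [S] is computed by at most [#|L|] rounds of
   backward propagation.

   On the input word this is a first-order condition over positions, with the
   order and the comparison of the unary numbers as atoms, plus one monadic
   least fixed point. A formula becomes a multi-tape machine: each variable has
   a tape holding a copy of the input, whose head position is the value of the
   variable, quantifiers are sweeps of such a head, atoms are lockstep moves of
   two heads, and [S] is a set of marks on one more tape. *)

Require Import Defs.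
From mathcomp Require Import all_boot all_order all_algebra.
From mathcomp Require Import zify.

Set Implicit Arguments.
Unset Strict Implicit.
Unset Printing Implicit Defensive.

(** * Machines with boolean exits *)

(** The language contains exact encodings only, so the machine must also recognise them. This stays
    first-order: a word is a leading number followed by items, each a symbol with a number, and the
    conditions concern neighbouring items, bounds, strict increase and occurrence of numbers. Strict
    increase of the listed assumptions and members matches the enumeration order used by [encode];
    it lets a word be decoded over the ordinals below its leading number, whatever type of sentences
    it came from.

    Testing conflicts and attacks by at most one rule is correct for a closed candidate, so
    closedness is tested alongside.

    Marks are set in place, so a pass also sees the marks made earlier in the same pass. Soundness
    is indifferent to this, since a test against any set of correct marks yields a correct mark;
    completeness needs only that each pass sees at least the marks of the earlier rounds. The rounds
    are counted by a head running over the word, and the leading number makes the word at least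
    [#|L|] long. *)

Section Machines.

Variables (S W : finType) (k : nat).

Definition obs := {ffun 'I_k.+1 -> option (S + W)}.
Definition action := {ffun 'I_k.+1 -> option (S + W) * direction}.
Definition tapes := 'I_k.+1 -> tape (S + W).

Definition scan (T : tapes) : obs := [ffun i => scanned (T i)].
Definition act (a : action) (T : tapes) : tapes := fun i => write_move (T i) (a i).

Record mach := Mach {
  mst : finType;
  mst0 : mst;
  mtr : mst -> obs -> (mst + bool) * action
}.

Inductive runs (M : mach) : mst M -> tapes -> nat -> tapes -> bool -> Prop :=
| runs_exit s T a b of mtr s (scan T) = (inr b, a) : runs s T 1 (act a T) b
| runs_step s T a s' t T' b of mtr s (scan T) = (inl s', a)
    & runs s' (act a T) t T' b : runs s T t.+1 T' b.

Definition prim (f : obs -> action) (b : obs -> bool) : mach :=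
  @Mach unit tt (fun _ o => (inr (b o), f o)).

(** The exit transition of [M] leads straight to the start state of [M1] or [M2], so running times
    simply add. *)
Definition branch (M M1 M2 : mach) : mach :=
  @Mach (mst M + (mst M1 + mst M2))%type (inl (mst0 M))
    (fun s o => match s with
     | inl s => let: (r, a) := mtr s o in
         (inl match r with
          | inl s' => inl s'
          | inr true => inr (inl (mst0 M1))
          | inr false => inr (inr (mst0 M2))
          end, a)
     | inr (inl s) => let: (r, a) := mtr s o in
         (match r with inl s' => inl (inr (inl s')) | inr b => inr b end, a)
     | inr (inr s) => let: (r, a) := mtr s o in
         (match r with inl s' => inl (inr (inr s')) | inr b => inr b end, a)
     end).

Definition seqm (M M1 : mach) : mach := branch M M1 M1.

(** Exit [true] of the body asks for another round, so a loop can only exit with [false]; what it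
    has found must be read off the heads afterwards. *)
Definition loop (M : mach) : mach :=
  @Mach (mst M) (mst0 M)
    (fun s o => let: (r, a) := mtr s o in
     (match r with inr true => inl (mst0 M) | _ => r end, a)).

Lemma runs_branch1 M M1 M2 s T t T' b t' T'' b' :
  runs (M := M) s T t T' b ->
  (if b then runs (mst0 M1) T' t' T'' b' else runs (mst0 M2) T' t' T'' b') ->
  runs (M := branch M M1 M2) (inl s) T (t + t') T'' b'.
Proof.
have H1 s1 U u U' c : runs (M := M1) s1 U u U' c ->
    runs (M := branch M M1 M2) (inr (inl s1)) U u U' c.
  elim=> {s1 U u U' c} [s1 U a c E | s1 U a s1' u U' c E _ IH].
    by apply: runs_exit; rewrite /= E.
  by apply: runs_step IH; rewrite /= E.
have H2 s1 U u U' c : runs (M := M2) s1 U u U' c ->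
    runs (M := branch M M1 M2) (inr (inr s1)) U u U' c.
  elim=> {s1 U u U' c} [s1 U a c E | s1 U a s1' u U' c E _ IH].
    by apply: runs_exit; rewrite /= E.
  by apply: runs_step IH; rewrite /= E.
elim=> {s T t T' b} [s T a b E | s T a s' t T' b E _ IH] H; last first.
  by rewrite addSn; apply: runs_step (IH H); rewrite /= E.
rewrite add1n; case: b E H => E H.
  by apply: runs_step (H1 _ _ _ _ _ H); rewrite /= E.
by apply: runs_step (H2 _ _ _ _ _ H); rewrite /= E.
Qed.

Lemma runs_loop_exit M s T t T' :
  runs (M := M) s T t T' false -> runs (M := loop M) s T t T' false.
Proof.
move eb: false => b H; elim: H eb => {s T t T' b}
  [s T a b E eb | s T a s' t T' b E _ IH eb].
  by apply: runs_exit; rewrite /= E -eb.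
by apply: runs_step (IH eb); rewrite /= E.
Qed.

Lemma runs_loop_next M s T t T' t' T'' b' :
  runs (M := M) s T t T' true -> runs (M := loop M) (mst0 M) T' t' T'' b' ->
  runs (M := loop M) s T (t + t') T'' b'.
Proof.
move eb: true => b H; elim: H eb => {s T t T' b}
  [s T a b E eb | s T a s' t T' b E _ IH eb] H.
  by apply: runs_step H; rewrite /= E -eb.
by rewrite addSn; apply: runs_step (IH eb H); rewrite /= E.
Qed.

Definition tm_of (M : mach) : tm S :=
  @TM S k (mst M + bool)%type W (inl (mst0 M))
    (fun s => if s is inr b then Some b else None)
    (fun s o => match s with
     | inl s => mtr s o
     | inr b => (inr b, [ffun i => (o i, MoveN)])
     end).

Lemma iter_tm_of M s T t T' b : runs (M := M) s T t T' b ->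
  iter t (@tm_step S (tm_of M)) (@Config S (tm_of M) (inl s) T) =
  @Config S (tm_of M) (inr b) T'.
Proof.
elim=> {s T t T' b} [s T a b E | s T a s' t T' b E _ IH].
  by rewrite /= /tm_step /=; move: E; rewrite /scan => ->.
by rewrite iterSr {2}/tm_step /=; move: E; rewrite /scan => ->; apply: IH.
Qed.

(** * Timed specifications of machines *)

Section Specs.

Variables (store : Type) (rep : store -> tapes -> Prop).

(** A total-correctness triple with a time bound. The store fixes the outcome, while [rep] is a
    relation, so part of the tape contents may be left open. *)
Variant does (M : mach) (t : nat) (s s' : store) (b : bool) : Prop :=
  Does of forall T, rep s T -> exists T' u,
    [/\ u <= t, runs (mst0 M) T u T' b & rep s' T'].

Lemma does_le M t t' s s' b : t <= t' -> does M t s s' b -> does M t' s s' b.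
Proof.
move=> le [H]; constructor=> T /H[T' [u [lu r R]]]; exists T', u; split=> //.
exact: leq_trans le.
Qed.

Lemma does_branch (c : bool) M M1 M2 t t' s s' s'' b :
  does M t s s' c -> (if c then does M1 t' s' s'' b else does M2 t' s' s'' b) ->
  does (branch M M1 M2) (t + t') s s'' b.
Proof.
move=> [H] H'; constructor=> T /H[T' [u [lu r R]]].
have [T'' [u' [lu' r' R']]] : exists T'' u', [/\ u' <= t',
    if c then runs (mst0 M1) T' u' T'' b else runs (mst0 M2) T' u' T'' b
    & rep s'' T''] by case: (c) H' => -[/(_ T' R)].
by exists T'', (u + u'); split=> //; [lia | exact: runs_branch1 r r'].
Qed.

Lemma does_seqm c M M1 t t' s s' s'' b :
  does M t s s' c -> does M1 t' s' s'' b -> does (seqm M M1) (t + t') s s'' b.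
Proof. by move=> H H'; apply: does_branch H _; case: c. Qed.

Lemma does_loop M t (s : nat -> store) n s' :
  (forall j, j < n -> does M t (s j) (s j.+1) true) ->
  does M t (s n) s' false -> does (loop M) (n.+1 * t) (s 0) s' false.
Proof.
elim: n s => [|n IH] s H [He]; constructor=> T.
  move=> /He[T' [u [lu r R]]]; exists T', u.
  by split=> //; [rewrite mul1n | exact: runs_loop_exit].
have [H0] := H 0 isT; move=> /H0[T1 [u [lu r R1]]].
have H1 j : j < n -> does M t (s j.+1) (s j.+2) true by move=> ?; apply: H.
have [IH'] := IH (fun j => s j.+1) H1 (Does He).
have [T' [u' [lu' r' R']]] := IH' T1 R1.
exists T', (u + u'); split=> //; last exact: runs_loop_next r r'.
by rewrite mulSn; lia.
Qed.

End Specs.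

End Machines.

(** * Formulas over word positions *)

(* Tape 0 holds the raw input and is only used for initialisation, tape 1 the
   marks, tape 2 is a counter, and the others are the variables of formulas. *)
Notation tapeno := 'I_12.
Definition raw : tapeno := ord0.
Definition mrk : tapeno := @Ordinal 12 1 isT.
Definition cnt : tapeno := @Ordinal 12 2 isT.

(* Left end, right end, input symbol, mark. *)
Definition cell : finType := (bool * bool * option symbol * bool)%type.

Notation wmach := (mach symbol cell 11).
Notation wobs := (obs symbol cell 11).
Notation waction := (action symbol cell 11).
Notation wtapes := (tapes symbol cell 11).

Definition look (o : wobs) (i : tapeno) : cell :=
  if o i is Some (inr c) then c else (false, false, None, false).
Definition at_left (o : wobs) i := (look o i).1.1.1.
Definition at_right (o : wobs) i := (look o i).1.1.2.
Definition sym (o : wobs) i := (look o i).1.2.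
Definition marked (o : wobs) i := (look o i).2.

Definition moves (R L : pred tapeno) (o : wobs) : waction :=
  [ffun i => (o i, if R i then MoveR else if L i then MoveL else MoveN)].
Definition mark_action (o : wobs) : waction :=
  [ffun i => (if i == mrk then Some (inr ((look o i).1, true)) else o i, MoveN)].
Definition move R L : wmach := prim (moves R L) (fun=> true).
Definition test (b : wobs -> bool) : wmach := prim (moves pred0 pred0) b.
Definition ret (b : bool) : wmach := test (fun=> b).
Definition while (b : wobs -> bool) (R L : pred tapeno) : wmach :=
  loop (branch (test b) (move R L) (ret false)).

(* Tape [c], resting at its left end, counts the moves of the other heads so
   that they can be undone after [M] has looked at the cells reached. *)
Definition probe (c : tapeno) (R L : pred tapeno) (b : wobs -> bool) (M : wmach) :=
  let restore := while (fun o => ~~ at_left o c) L (predU1 c R) in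
  seqm (while b (predU1 c R) L)
       (branch M (seqm restore (ret true)) (seqm restore (ret false))).

Definition reset (x : tapeno) := while (fun o => ~~ at_left o x) pred0 (pred1 x).

Definition for_loop (x : tapeno) (M : wmach) : wmach :=
  seqm (loop (branch (test (at_right^~ x)) (ret false)
                     (seqm M (move (pred1 x) pred0))))
       (reset x).

Inductive formula :=
| Sym of symbol & tapeno
| NumLe of tapeno & tapeno
| Before of tapeno & tapeno
| Marked of tapeno
| Neg of formula
| And of formula & formula
| Ex of tapeno & formula.

Fixpoint bound (p : formula) : seq tapeno :=
  match p with
  | Neg p => bound p
  | And p q => bound p ++ bound q
  | Ex x p => x :: bound p
  | _ => [::]
  end.

(** The head of a variable is the only record of its value, so a quantifier must not be nested
    inside another one over the same variable; the two sides of a conjunction may share one. Tapes 0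
    to 2 are reserved. *)
Fixpoint wf (p : formula) : bool :=
  match p with
  | Sym _ x | Marked x => 2 < x
  | NumLe x y | Before x y => (2 < x) && (2 < y)
  | Neg p => wf p
  | And p q => wf p && wf q
  | Ex x p => [&& 2 < x, x \notin bound p & wf p]
  end.

Definition env := tapeno -> nat.
Definition upd (e : env) (x : tapeno) (n : nat) : env :=
  fun y => if y == x then n else e y.

(* The number written after position [i]; at position 0 of an input this is one
   less than the number of sentences. *)
Definition num (w : seq symbol) (i : nat) : nat :=
  find (predC1 Tick) (drop i.+1 w).

Fixpoint eval (w : seq symbol) (mk : pred nat) (p : formula) (e : env) : bool :=
  match p with
  | Sym s x => onth w (e x) == Some s
  | NumLe x y => num w (e x) <= num w (e y)
  | Before x y => e x < e y
  | Marked x => mk (e x)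
  | Neg p => ~~ eval w mk p e
  | And p q => eval w mk p e && eval w mk q e
  | Ex x p => has (fun n => eval w mk p (upd e x n)) (iota 0 (size w))
  end.

(** In [NumLe], the disjunct [at_left o cnt] forces the first move, off the two delimiters and onto
    their numbers. In [Ex], the search stops at a witness or at the right end, and the test that
    follows tells which. *)
Fixpoint compile (p : formula) : wmach :=
  match p with
  | Sym s x => test (fun o => sym o x == Some s)
  | NumLe x y => probe cnt (pred2 x y) pred0
      (fun o => at_left o cnt
                || (sym o x == Some Tick) && (sym o y == Some Tick))
      (test (fun o => sym o x != Some Tick))
  | Before x y => probe cnt pred0 (pred2 x y)
      (fun o => ~~ at_left o x && ~~ at_left o y)
      (test (fun o => at_left o x && ~~ at_left o y))
  | Marked x => probe mrk pred0 (pred1 x) (fun o => ~~ at_left o x)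
      (test (marked^~ mrk))
  | Neg p => branch (compile p) (ret false) (ret true)
  | And p q => branch (compile p) (compile q) (ret false)
  | Ex x p =>
      seqm (loop (branch (test (at_right^~ x)) (ret false)
                   (branch (compile p) (ret false) (move (pred1 x) pred0))))
        (branch (test (at_right^~ x))
           (seqm (reset x) (ret false)) (seqm (reset x) (ret true)))
  end.

(** The bound for atoms is that of a probe: [2 * n.+1] steps on the way out, as many on the way
    back, one for the test made there and one to return its result. *)
Fixpoint cost (p : formula) (n : nat) : nat :=
  match p with
  | Neg p => cost p n + 1
  | And p q => cost p n + (cost q n + 1)
  | Ex x p => n.+1 * (cost p n + 2) + (2 * n.+1 + 2)
  | _ => 4 * n.+1 + 2
  end.

Definition mark_at (x : tapeno) : wmach :=
  probe mrk pred0 (pred1 x) (fun o => ~~ at_left o x)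
    (prim mark_action (fun=> true)).

Definition sweep (x : tapeno) (p : formula) : wmach :=
  for_loop x (branch (compile p) (mark_at x) (ret true)).

(** * Correctness of the compiled machines *)

Section Correct.

Variable w : seq symbol.
Notation N := (size w).

Definition content (mk : pred nat) (i : tapeno) (j : nat) : cell :=
  (j == 0, j == N, onth w j, (i == mrk) && mk j).

(* Tape contents [f 0 .. f N] with the head at [p]. *)
Definition zipper (f : nat -> cell) (p : nat) : tape (symbol + cell) :=
  let c j := Some (inr (f j)) in
  Tape (rev (map c (iota 0 p))) (c p) (map c (iota p.+1 (N - p))).

(** All tapes except [raw] hold cells [0 .. N], where cell [N] is a sentinel without symbol. Nothing
    is said about [raw], whose head and contents may be anything once the input has been copied. *)
Definition rep (s : env * pred nat) (T : wtapes) : Prop :=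
  forall i, i != raw -> s.1 i <= N /\ T i = zipper (content s.2 i) (s.1 i).

Notation doesw := (does rep).

Lemma look_rep s T i : rep s T -> i != raw ->
  look (scan T) i = content s.2 i (s.1 i).
Proof. by move=> H /H[_ E]; rewrite /look /scan ffunE E. Qed.

(** Stores consist of functions, and head moves produce them only up to pointwise equality;
    specifications are therefore transported along [=1]. *)
Lemma rep_ext s s' T : s.1 =1 s'.1 -> s.2 =1 s'.2 -> rep s T -> rep s' T.
Proof.
move=> E1 E2 H i i0; have [le E] := H i i0; rewrite -E1 E; split=> //.
rewrite /zipper /content E2.
by congr Tape; [congr rev|]; apply: eq_map => j; rewrite E2.
Qed.

Lemma does_ext M t e mk s' e' mk' b : doesw M t (e, mk) s' b ->
  e =1 e' -> mk =1 mk' -> doesw M t (e', mk') s' b.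
Proof.
move=> [H] E1 E2; constructor=> T R; apply: H.
by apply: rep_ext R => /= x; rewrite ?E1 ?E2.
Qed.

Lemma does_ext2 M t s e mk e' mk' b : doesw M t s (e, mk) b ->
  e =1 e' -> mk =1 mk' -> doesw M t s (e', mk') b.
Proof.
move=> [H] E1 E2; constructor=> T /H[T' [u [lu r R]]]; exists T', u; split=> //.
exact: rep_ext R.
Qed.

Definition shift (R L : pred tapeno) (e : env) (n : nat) : env :=
  fun i => if R i then e i + n else if L i then e i - n else e i.

Lemma rev_iotaS T (c : nat -> T) p :
  rev (map c (iota 0 p.+1)) = c p :: rev (map c (iota 0 p)).
Proof. by rewrite -[p.+1]addn1 iotaD map_cat cats1 rev_rcons. Qed.

Lemma zipper_right f p : p < N ->
  write_move (zipper f p) (scanned (zipper f p), MoveR) = zipper f p.+1.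
Proof.
move=> lt; rewrite /zipper rev_iotaS.
by have -> : N - p = (N - p.+1).+1 by lia.
Qed.

Lemma zipper_left f p : 0 < p <= N ->
  write_move (zipper f p) (scanned (zipper f p), MoveL) = zipper f p.-1.
Proof.
case: p => // p lt; rewrite /zipper rev_iotaS.
by have -> : N - p.+1.-1 = (N - p.+1).+1 by lia.
Qed.

Lemma rep_moves (R L : pred tapeno) e mk T : rep (e, mk) T ->
  (forall i, i != raw -> R i -> e i < N) ->
  (forall i, i != raw -> ~~ R i -> L i -> 0 < e i) ->
  rep (shift R L e 1, mk) (act (moves R L (scan T)) T).
Proof.
move=> H HR HL i i0; have [/= le E] := H i i0.
rewrite /act /moves !ffunE E /= /shift.
have [Ri|Ri] := boolP (R i).
  have lt := HR i i0 Ri; rewrite addn1; split=> //.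
  exact: zipper_right.
have [Li|Li] := boolP (L i); last by split.
have lt := HL i i0 Ri Li; rewrite subn1; split; first by lia.
by rewrite -zipper_left ?lt.
Qed.

Lemma does_move (R L : pred tapeno) e mk :
  (forall i, i != raw -> R i -> e i < N) ->
  (forall i, i != raw -> ~~ R i -> L i -> 0 < e i) ->
  doesw (move R L) 1 (e, mk) (shift R L e 1, mk) true.
Proof.
move=> HR HL; constructor=> T H; exists (act (moves R L (scan T)) T), 1; split=> //.
  exact: runs_exit.
exact: rep_moves.
Qed.

Definition sees (q : wobs -> bool) s b := forall T, rep s T -> q (scan T) = b.

Lemma does_test q s b : sees q s b -> doesw (test q) 1 s s b.
Proof.
case: s => e mk H; constructor=> T HT; exists (act (moves pred0 pred0 (scan T)) T), 1.
split=> //; first by apply: runs_exit; rewrite /= H.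
by apply: rep_ext (rep_moves (R := pred0) (L := pred0) HT _ _).
Qed.

Lemma does_ret s b : doesw (ret b) 1 s s b.
Proof. exact: does_test. Qed.

Lemma sees_left s i : i != raw -> sees (at_left^~ i) s (s.1 i == 0).
Proof. by move=> i0 T H; rewrite /at_left (look_rep H). Qed.

Lemma sees_right s i : i != raw -> sees (at_right^~ i) s (s.1 i == N).
Proof. by move=> i0 T H; rewrite /at_right (look_rep H). Qed.

Lemma does_while q (R L : pred tapeno) e mk n :
  (forall j, j < n -> sees q (shift R L e j, mk) true) ->
  sees q (shift R L e n, mk) false ->
  (forall i, i != raw -> R i -> e i + n <= N) ->
  (forall i, i != raw -> ~~ R i -> L i -> n <= e i) ->
  doesw (while q R L) (2 * n.+1) (e, mk) (shift R L e n, mk) false.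
Proof.
move=> Ht Hf HR HL.
have E0 : shift R L e 0 =1 e by move=> i; rewrite /shift addn0 subn0 !if_same.
apply: (does_ext (e := shift R L e 0) (mk := mk)) => //.
rewrite mulnC; apply: (does_loop (s := fun j => (shift R L e j, mk))).
  move=> j lt; rewrite -[2]/(1 + 1).
  apply: (does_branch (c := true)); first exact/does_test/Ht.
  apply: does_ext2 (does_move _ _ _) _ _ => //.
  - by move=> i i0 Ri; rewrite /shift Ri; have := HR i i0 Ri; lia.
  - move=> i i0 Ri Li; rewrite /shift (negbTE Ri) Li.
    by have := HL i i0 Ri Li; lia.
  - by move=> i; rewrite /shift; case: (R i); [lia | case: (L i); lia].
rewrite -[2]/(1 + 1); apply: (does_branch (c := false)); first exact/does_test.
exact: does_ret.
Qed.

(** The counter starts at 0 and moves right on the way out, so after [j] moves back it stands at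
    [n - j]: it reaches its left end exactly when all other heads are home. The inner machine may
    change marks but no head position. *)
Lemma does_probe c (R L : pred tapeno) q M e mk mk' n b :
  c != raw -> e c = 0 -> ~~ L c -> (forall i, R i -> ~~ L i) ->
  (forall i, L i -> e i <= N) -> n <= N -> (forall i, R i -> e i + n <= N) -> (forall i, L i -> n <= e i) ->
  (forall j, j < n -> sees q (shift (predU1 c R) L e j, mk) true) ->
  sees q (shift (predU1 c R) L e n, mk) false ->
  doesw M 1 (shift (predU1 c R) L e n, mk) (shift (predU1 c R) L e n, mk') b ->
  doesw (probe c R L q M) (4 * N.+1 + 2) (e, mk) (e, mk') b.
Proof.
move=> c0 ec Lc RL H0 nN HR HL Ht Hf HM.
have HcR i : predU1 c R i -> e i + n <= N.
  by case/predU1P => [->|/HR //]; rewrite ec.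
have LcR i : L i -> predU1 c R i = false.
  move=> Li; apply/negbTE/negP => /predU1P[ic|Ri]; first by rewrite -ic Li in Lc.
  by rewrite (negbTE (RL i Ri)) in Li.
pose e1 := shift (predU1 c R) L e n.
have back j : j <= n -> shift L (predU1 c R) e1 j =1
    shift (predU1 c R) L e (n - j).
  move=> jn i; rewrite /e1 /shift /=; case: (eqVneq i c) => [->|ne] /=.
    by rewrite (negbTE Lc); lia.
  have [Ri|Ri] := boolP (R i); first by rewrite (negbTE (RL i Ri)); lia.
  by have [Li|Li] //= := boolP (L i); have := HL i Li; lia.
have Rest : doesw (while (fun o => ~~ at_left o c) L (predU1 c R)) (2 * n.+1)
    (e1, mk') (e, mk') false.
  apply: (does_ext2 (e := shift L (predU1 c R) e1 n) (mk := mk')) => //.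
    apply: does_while.
    - move=> j lt T HT; rewrite (sees_left c0 HT) /= (back _ (ltnW lt)).
      by rewrite /shift /= eqxx ec /=; apply/eqP; lia.
    - move=> T HT; rewrite (sees_left c0 HT) /= (back _ (leqnn n)).
      by rewrite /shift /= eqxx ec /= subnn.
    - move=> i i0 Li; have := HL i Li; rewrite /e1 /shift (LcR i Li) Li.
      have le := H0 i Li; lia.
    - move=> i i0 _ Ri; rewrite /e1 /shift Ri; lia.
  by move=> i; rewrite back // subnn /shift addn0 subn0 !if_same.
apply: does_le (_ : 2 * n.+1 + (1 + (2 * n.+1 + 1)) <= _) _; first by lia.
apply: does_seqm; first apply: does_while Ht Hf _ _.
- by move=> i _; apply: HcR.
- by move=> i _ _; apply: HL.
apply: does_branch; first exact: HM.
by case: (b); apply: does_seqm Rest _; apply: does_ret.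
Qed.

Lemma does_reset x e mk : x != raw -> e x <= N ->
  doesw (reset x) (2 * N.+1) (e, mk) (upd e x 0, mk) false.
Proof.
move=> x0 le; apply: does_le (_ : 2 * (e x).+1 <= _) _; first by lia.
apply: (does_ext2 (e := shift pred0 (pred1 x) e (e x)) (mk := mk)) => //.
  apply: does_while => //.
  - move=> j lt T HT; rewrite (sees_left x0 HT) /shift /= eqxx.
    by apply/eqP; lia.
  - by move=> T HT; rewrite (sees_left x0 HT) /shift /= eqxx subnn.
  - by move=> i _ _ /eqP ->.
by move=> i; rewrite /shift /upd /=; case: eqP => // ->; rewrite subnn.
Qed.

Lemma shift_pred1 x e n : shift (pred1 x) pred0 (upd e x n) 1 =1 upd e x n.+1.
Proof. by move=> i; rewrite /shift /upd /=; case: eqP => //; lia. Qed.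

Lemma does_incr x e mk n : x != raw -> n < N ->
  doesw (move (pred1 x) pred0) 1 (upd e x n, mk) (upd e x n.+1, mk) true.
Proof.
move=> x0 lt; apply: does_ext2 (does_move _ _ _) (shift_pred1 _ _ _) _ => //.
by move=> i _ /eqP ->; rewrite /upd eqxx.
Qed.

Lemma does_for x M t e (mk : nat -> pred nat) : x != raw -> e x = 0 ->
  (forall j, j < N -> exists b,
     doesw M t (upd e x j, mk j) (upd e x j, mk j.+1) b) ->
  doesw (for_loop x M) (N.+1 * (t + 2) + 2 * N.+1) (e, mk 0) (e, mk N) false.
Proof.
move=> x0 ex H.
have upd0 y : upd e x 0 y = e y by rewrite /upd; case: eqP => // ->.
have right_x j mk' : sees (at_right^~ x) (upd e x j, mk') (j == N).
  by move=> T /sees_right -> //; rewrite /= /upd eqxx.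
apply: (does_ext (e := upd e x 0) (mk := mk 0)) => //.
apply: (does_seqm (s' := (upd e x N, mk N)) (c := false)).
  apply: (does_loop (s := fun j => (upd e x j, mk j))) => [j lt|].
    apply: does_le (_ : 1 + (t + 1) <= _) _; first by lia.
    apply: (does_branch (c := false)).
      by apply: does_test => T /right_x ->; lia.
    have [b Hb] := H j lt; apply: does_seqm Hb _.
    exact: does_incr.
  apply: does_le (_ : 1 + 1 <= _) _; first by lia.
  apply: (does_branch (c := true)).
    by apply: does_test => T /right_x ->; rewrite eqxx.
  exact: does_ret.
apply: does_ext2 (does_reset _ _ _) _ _ => //; rewrite /upd ?eqxx //.
by move=> y; case: eqP => // ->.
Qed.

Lemma gt2_neq (x : tapeno) : 2 < x -> [/\ x != raw, x != mrk & x != cnt].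
Proof. by move=> lt; split; apply/eqP => E; rewrite E in lt. Qed.

(** The precondition of a compiled formula: the counters and the heads still to be quantified are at
    the left end, where every sweep starts and where it returns, and no variable stands on the
    sentinel. *)
Definition clean (p : formula) (e : env) :=
  [/\ e cnt = 0, e mrk = 0, forall x, x \in bound p -> e x = 0
    & forall x : tapeno, 2 < x -> e x < N].

Lemma onth_find_tick s j : j <= find (predC1 Tick) s ->
  (onth s j == Some Tick) = (j < find (predC1 Tick) s).
Proof.
elim: s j => [|a s IH] [|j] //=; have [E|ne] := eqVneq a Tick => //=; rewrite ?E ?eqxx //.
  by move=> _; apply/eqP => -[/eqP]; rewrite (negbTE ne).
exact: IH.
Qed.

Lemma onth_num i j : j <= num w i ->
  (onth w (i + j.+1) == Some Tick) = (j < num w i).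
Proof.
move=> le; rewrite -onth_find_tick //; congr (_ == _).
by rewrite !onthE map_drop nth_drop addSnnS.
Qed.

Lemma num_lt i : i < N -> i + num w i < N.
Proof.
have := find_size (predC1 Tick) (drop i.+1 w).
by rewrite -/(num w i) size_drop -ltnS; move: (num w i) (size w) => m n; lia.
Qed.

Lemma does_numle (x y : tapeno) e mk : 2 < x -> 2 < y -> clean (NumLe x y) e ->
  doesw (compile (NumLe x y)) (4 * N.+1 + 2) (e, mk) (e, mk)
    (num w (e x) <= num w (e y)).
Proof.
move=> x2 y2 [ec em _ eN].
have [x0 xm xc] := gt2_neq x2; have [y0 ym yc] := gt2_neq y2.
have lx := num_lt (eN x x2); have ly := num_lt (eN y y2).
set m := minn (num w (e x)) (num w (e y)).
have look_x j T : rep (shift (predU1 cnt (pred2 x y)) pred0 e j, mk) T ->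
    sym (scan T) x = onth w (e x + j).
  by move=> HT; rewrite /sym (look_rep HT) //= /shift /= eqxx orbT.
have look_y j T : rep (shift (predU1 cnt (pred2 x y)) pred0 e j, mk) T ->
    sym (scan T) y = onth w (e y + j).
  by move=> HT; rewrite /sym (look_rep HT) //= /shift /= eqxx !orbT.
have left_c j T : rep (shift (predU1 cnt (pred2 x y)) pred0 e j, mk) T ->
    at_left (scan T) cnt = (j == 0).
  by move=> HT; rewrite (sees_left _ HT) //= /shift /= ec.
(* One move off the delimiters, then one for each tick that the two numbers share. The head of [x]
   has then run out of ticks exactly when its number is the minimum. *)
apply: (does_probe (n := m.+1)) => //=.
- by lia.
- by move=> i /orP[] /eqP ->; lia.
- case=> [|j] lt T HT; first by rewrite (left_c _ _ HT).
  rewrite (look_x _ _ HT) (look_y _ _ HT) !onth_num; lia.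
- move=> T HT; rewrite (left_c _ _ HT) (look_x _ _ HT) (look_y _ _ HT) /=.
  rewrite !onth_num; lia.
- apply: does_test => T HT; rewrite (look_x _ _ HT) onth_num; lia.
Qed.

Lemma does_before (x y : tapeno) e mk : 2 < x -> 2 < y -> clean (Before x y) e ->
  doesw (compile (Before x y)) (4 * N.+1 + 2) (e, mk) (e, mk) (e x < e y).
Proof.
move=> x2 y2 [ec em _ eN].
have [x0 xm xc] := gt2_neq x2; have [y0 ym yc] := gt2_neq y2.
have lx := eN x x2; have ly := eN y y2.
have left_x j T : rep (shift (predU1 cnt pred0) (pred2 x y) e j, mk) T ->
    at_left (scan T) x = (e x - j == 0).
  by move=> HT; rewrite (sees_left _ HT) //= /shift /= (negbTE xc) eqxx.
have left_y j T : rep (shift (predU1 cnt pred0) (pred2 x y) e j, mk) T ->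
    at_left (scan T) y = (e y - j == 0).
  by move=> HT; rewrite (sees_left _ HT) //= /shift /= (negbTE yc) eqxx orbT.
apply: (does_probe (n := minn (e x) (e y))) => //=.
- by rewrite negb_or eq_sym xc eq_sym yc.
- by move=> i /orP[] /eqP ->; lia.
- by lia.
- by move=> i /orP[] /eqP ->; lia.
- by move=> j lt T HT; rewrite (left_x _ _ HT) (left_y _ _ HT); lia.
- by move=> T HT; rewrite (left_x _ _ HT) (left_y _ _ HT); lia.
- by apply: does_test => T HT; rewrite (left_x _ _ HT) (left_y _ _ HT); lia.
Qed.

(** Here the mark tape itself is the counter: its head goes right while that of [x] returns to 0,
    and so arrives at the position that [x] denotes. *)
Lemma does_at_mark M (x : tapeno) e mk mk' b : 2 < x -> e mrk = 0 -> e x < N ->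
  (forall e', e' mrk = e x -> doesw M 1 (e', mk) (e', mk') b) ->
  doesw (probe mrk pred0 (pred1 x) (fun o => ~~ at_left o x) M) (4 * N.+1 + 2)
    (e, mk) (e, mk') b.
Proof.
move=> x2 em ltx HM; have [x0 xm xc] := gt2_neq x2.
have left_x j T : rep (shift (predU1 mrk pred0) (pred1 x) e j, mk) T ->
    at_left (scan T) x = (e x - j == 0).
  by move=> HT; rewrite (sees_left _ HT) //= /shift /= (negbTE xm) eqxx.
apply: (does_probe (n := e x)) => //=.
- by rewrite eq_sym.
- by move=> i /eqP ->; lia.
- by lia.
- by move=> i /eqP ->.
- by move=> j lt T HT; rewrite (left_x _ _ HT); lia.
- by move=> T HT; rewrite (left_x _ _ HT); lia.
- by apply: HM; rewrite /shift /= em.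
Qed.

Lemma does_mark_at (x : tapeno) e mk : 2 < x -> e mrk = 0 -> e x < N ->
  doesw (mark_at x) (4 * N.+1 + 2) (e, mk) (e, fun j => (j == e x) || mk j) true.
Proof.
move=> x2 em ltx; apply: does_at_mark => // e' e'm; constructor=> T HT.
exists (act (mark_action (scan T)) T), 1; split=> //; first exact: runs_exit.
move=> i i0; have [/= le E] := HT i i0; rewrite /act /mark_action !ffunE.
split=> //; have [im|im] := eqVneq i mrk; last first.
  rewrite E /= /zipper /content (negbTE im) /=.
  by congr Tape.
rewrite (look_rep HT) // E /= /zipper /content im eqxx /= e'm.
have far (s : seq nat) : e x \notin s ->
    [seq Some (inr (j == 0, j == N, onth w j, mk j)) | j <- s] =
    [seq Some (inr (j == 0, j == N, onth w j, (j == e x) || mk j)) | j <- s]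
    :> seq (option (symbol + cell)).
  move=> nx; apply/eq_in_map => j js; case: (eqVneq j (e x)) => // jx.
  by rewrite -jx js in nx.
by congr Tape; rewrite ?far ?eqxx // mem_iota; lia.
Qed.

Lemma does_ex (x : tapeno) p t e mk (P : pred nat) : 2 < x -> e x = 0 ->
  (forall j, j < N -> doesw (compile p) t (upd e x j, mk) (upd e x j, mk) (P j)) ->
  doesw (compile (Ex x p)) (N.+1 * (t + 2) + (2 * N.+1 + 2)) (e, mk) (e, mk)
    (has P (iota 0 N)).
Proof.
move=> x2 ex H; have [x0 xm xc] := gt2_neq x2.
have upd0 y : upd e x 0 y = e y by rewrite /upd; case: eqP => // ->.
apply: (does_ext (e := upd e x 0) (mk := mk)) => //.
have right_x j : sees (at_right^~ x) (upd e x j, mk) (j == N).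
  by move=> T /sees_right -> //; rewrite /= /upd eqxx.
(* Without a witness [find] returns [N], the position of the sentinel, so both ways of leaving the
   loop end in the same store. *)
set n := find P (iota 0 N).
have nN : n <= N by have := find_size P (iota 0 N); rewrite size_iota.
apply: does_le (_ : n.+1 * (t + 2) + (1 + (2 * N.+1 + 1)) <= _) _.
  by apply: leq_add; [apply: leq_mul | lia].
apply: (does_seqm (s' := (upd e x n, mk)) (c := false)).
  apply: (does_loop (s := fun j => (upd e x j, mk))) => [j lt|].
    have jN : j < N by lia.
    apply: does_le (_ : 1 + (t + 1) <= _) _; first by lia.
    apply: (does_branch (c := false)).
      apply: does_test => T /right_x ->; lia.
    apply: does_branch (H j jN) _.
    have := before_find 0 lt; rewrite nth_iota // add0n => ->.
    exact: does_incr.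
  have [En|nN'] := eqVneq n N.
    apply: does_le (_ : 1 + 1 <= _) _; first by lia.
    apply: (does_branch (c := true)); last exact: does_ret.
    by apply: does_test => T /right_x ->; rewrite En eqxx.
  have ltn : n < N by lia.
  apply: does_le (_ : 1 + (t + 1) <= _) _; first by lia.
  apply: (does_branch (c := false)).
    by apply: does_test => T /right_x ->; apply/negbTE.
  apply: does_branch (H n ltn) _.
  have := ltn; rewrite -(size_iota 0 N) -has_find => /(nth_find 0).
  by rewrite -/n nth_iota // add0n => ->; apply: does_ret.
have Hr b : doesw (seqm (reset x) (ret b)) (2 * N.+1 + 1) (upd e x n, mk) (e, mk) b.
  apply: does_seqm (does_ret _ _).
  apply: does_ext2 (does_reset _ _ _) _ _ => //; rewrite /upd ?eqxx //.
  by move=> y; case: eqP => // ->.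
apply: does_branch; first by apply: does_test; apply: right_x.
have -> : has P (iota 0 N) = (n != N).
  by rewrite has_find size_iota -/n; lia.
by case: eqP => _; apply: Hr.
Qed.

Lemma does_compile p e mk : wf p -> clean p e ->
  doesw (compile p) (cost p N) (e, mk) (e, mk) (eval w mk p e).
Proof.
elim: p e => [s x|x y|x y|x|p IH|p IHp q IHq|x p IH] e.
- move=> /= /gt2_neq[x0 _ _] _; apply: does_le (does_test _); first by lia.
  by move=> T HT; rewrite /sym (look_rep HT).
- by case/andP; apply: does_numle.
- by case/andP; apply: does_before.
- move=> /= x2 [_ em _ /(_ _ x2) ex]; apply: does_at_mark => // e' e'm.
  apply: does_test => T HT; rewrite /marked (look_rep HT) //=.
  by rewrite e'm.
- move=> /= wp cp; apply: does_branch (IH e wp cp) _.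
  by case: eval; apply: does_ret.
- move=> /= /andP[wp wq] [ec em eb eN]; apply: does_branch (IHp e wp _) _.
    by split=> // x xp; apply: eb; rewrite mem_cat xp.
  case: eval; last by apply: does_le (does_ret _ _); lia.
  apply: does_le (IHq e wq _); first by lia.
  by split=> // x xp; apply: eb; rewrite mem_cat xp orbT.
- move=> /= /and3P[x2 xb wp] [ec em eb eN].
  have [x0 xm xc] := gt2_neq x2.
  apply: does_ex => //; first by apply: eb; rewrite inE eqxx.
  move=> j lt; apply: IH => //; split.
  + by rewrite /upd eq_sym (negbTE xc).
  + by rewrite /upd eq_sym (negbTE xm).
  + move=> y yb; rewrite /upd; case: eqP => [yx|_].
      by rewrite -yx yb in xb.
    by apply: eb; rewrite inE yb orbT.
  + by move=> y y2; rewrite /upd; case: eqP => // _; apply: eN.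
Qed.

End Correct.

(** * Marking, initialisation and running time *)

(** Position [n'] is tested against [m], which already includes the marks made at earlier positions
    of this pass. *)
Fixpoint mark_pass (f : pred nat -> pred nat) (mk : pred nat) (n : nat) : pred nat :=
  if n is n'.+1 then
    let m := mark_pass f mk n' in
    fun i => f m n' && (i == n') || m i
  else mk.

Fixpoint rounds (f : nat -> pred nat -> pred nat) (n k : nat) : pred nat :=
  if k is k'.+1 then mark_pass (f k') (rounds f n k') n else pred0.

Definition step_eval (w : seq symbol) (x y : tapeno) (p : formula) (k : nat)
    (mk : pred nat) (i : nat) : bool :=
  eval w mk p (upd (upd (fun=> 0) y k) x i).

(** The head of [y] counts the rounds: one sweep of [x] for each position of the word. As it belongs
    to the environment, the round number appears in [step_eval]. *)
Definition decider (x y : tapeno) (g p q : formula) : wmach :=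
  branch (compile g) (seqm (for_loop y (sweep x p)) (compile q)) (ret false).

Definition decider_cost (g p q : formula) (n : nat) : nat :=
  let s := n.+1 * (cost p n + (4 * n.+1 + 2) + 2) + 2 * n.+1 in
  cost g n + (n.+1 * (s + 2) + 2 * n.+1 + cost q n + 1).

(* The states [None], [Some false] and [Some true] respectively start copying,
   copy, and rewind. *)
Definition init : wmach :=
  let fill (o : wobs) (c : cell) (d : direction) : waction :=
    [ffun i => if i == raw then (o i, d) else (Some (inr c), d)] in
  @Mach symbol cell 11 (option bool) None (fun s o =>
    match s with
    | Some true => if at_left o mrk then (inr true, moves pred0 pred0 o)
                   else (inl (Some true), moves pred0 predT o)
    | _ => match o raw with
           | Some (inl a) =>
               (inl (Some false), fill o (s == None, false, Some a, false) MoveR)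
           | _ => if s is None then (inr false, moves pred0 pred0 o) else
                  (inl (Some true), fill o (false, true, None, false) MoveL)
           end
    end).

Definition raw_input (w : seq symbol) : wtapes :=
  fun i => input_tape (if i == raw then map inl w else [::]).

Section Correct.

Variable w : seq symbol.
Notation N := (size w).
Notation rep := (rep w).
Notation doesw := (does rep).

Lemma wf_Ex_gt2 x p : wf (Ex x p) -> 2 < x. Proof. by case/and3P. Qed.

Lemma clean_upd x p e j : wf (Ex x p) -> clean w (Ex x p) e -> j < N ->
  clean w p (upd e x j).
Proof.
move=> /= /and3P[x2 xb _] [ec em eb eN] lt.
have [x0 xm xc] := gt2_neq x2; split.
- by rewrite /upd eq_sym (negbTE xc).
- by rewrite /upd eq_sym (negbTE xm).
- move=> y yb; rewrite /upd; case: eqP => [yx|_].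
    by rewrite -yx yb in xb.
  by apply: eb; rewrite inE yb orbT.
- by move=> y y2; rewrite /upd; case: eqP => // _; apply: eN.
Qed.

Lemma does_sweep x p e mk : wf (Ex x p) -> clean w (Ex x p) e ->
  doesw (sweep x p) (N.+1 * (cost p N + (4 * N.+1 + 2) + 2) + 2 * N.+1) (e, mk)
    (e, mark_pass (fun m j => eval w m p (upd e x j)) mk N) false.
Proof.
move=> wp cp; have x2 := wf_Ex_gt2 wp; have [x0 xm xc] := gt2_neq x2.
apply: (does_for (mk := mark_pass (fun m j => eval w m p (upd e x j)) mk)) => //.
  by case: cp => _ _ eb _; apply: eb; rewrite inE eqxx.
move=> j lt; exists true => /=; have cj := clean_upd wp cp lt.
apply: does_branch (does_compile _ _ cj) _; first by case/and3P: wp.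
case: cj => _ em _ /(_ x x2) ex; case: eval => /=.
  apply: does_ext2 (does_mark_at _ _ _ _) _ _ => // i; by rewrite /upd eqxx.
by apply: does_le (does_ret _ _ _); lia.
Qed.

Lemma does_decider x y g p q : 0 < N -> wf g -> wf q -> wf (Ex y (Ex x p)) ->
  exists s', doesw (decider x y g p q) (decider_cost g p q N)
    (fun=> 0, pred0 : pred nat) s'
    (eval w pred0 g (fun=> 0) &&
     eval w (rounds (step_eval w x y p) N N) q (fun=> 0)).
Proof.
move=> N_gt0 wg wq wp; have c0 r : clean w r (fun=> 0) by split.
have y2 := wf_Ex_gt2 wp; have [y0 _ _] := gt2_neq y2.
have Hg := does_compile pred0 wg (c0 g).
case eg: (eval w pred0 g (fun=> 0)) Hg => Hg; last first.
  exists (fun=> 0, pred0 : pred nat); apply: does_branch Hg _.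
  by apply: does_le (does_ret _ _ _); lia.
exists (fun=> 0, rounds (step_eval w x y p) N N); apply: does_branch Hg _.
apply: does_le (_ : _ <= _) _; first exact: leq_addr.
apply: does_seqm (does_compile _ wq (c0 q)).
apply: (does_for (mk := rounds (step_eval w x y p) N)) => //.
move=> j lt; exists false => /=; apply: does_sweep; first by case/and3P: wp.
exact: clean_upd wp (c0 _) lt.
Qed.

Lemma runs_rewind p T : p <= N -> rep (fun=> p, pred0 : pred nat) T ->
  exists2 T', runs (M := init) (Some true) T p.+1 T' true
    & rep (fun=> 0, pred0 : pred nat) T'.
Proof.
elim: p T => [|p IH] T le HT.
  exists (act (moves pred0 pred0 (scan T)) T).
    by apply: runs_exit; rewrite /= (sees_left _ HT).
  exact: (rep_ext (s := (shift pred0 pred0 (fun=> 0) 1, pred0 : pred nat)) _ _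
    (rep_moves HT _ _)).
have HT' : rep (fun=> p, pred0 : pred nat) (act (moves pred0 predT (scan T)) T).
  apply: (rep_ext (s := (shift pred0 predT (fun=> p.+1) 1, pred0 : pred nat)) _ _
    (rep_moves HT _ _)) => // i; rewrite /shift /=; lia.
have [T' r R] := IH _ (ltnW le) HT'.
by exists T' => //; apply: runs_step r; rewrite /= (sees_left _ HT).
Qed.

Definition copying (j : nat) (T : wtapes) :=
  (exists l, T raw = Tape l (head None (map (some \o inl) (drop j w)))
                       (behead (map (some \o inl) (drop j w)))) /\
  forall i, i != raw ->
    T i = Tape (rev (map (fun n => Some (inr (content w pred0 i n))) (iota 0 j)))
          None [::].

Lemma contentE i j : content w pred0 i j = (j == 0, j == N, onth w j, false).
Proof. by rewrite /content andbF. Qed.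

Lemma runs_copy n j T : 0 < N -> n + j = N -> copying j T ->
  exists T' u, [/\ u <= n + N.+1,
    runs (M := init) (if j == 0 then None else Some false) T u T' true
    & rep (fun=> 0, pred0 : pred nat) T'].
Proof.
move=> N_gt0; elim: n j T => [|n IH] j T.
  rewrite add0n => -> [[l Er] Et].
  pose a : waction := [ffun i => if i == raw then (scan T i, MoveL)
                            else (Some (inr (false, true, None, false)), MoveL)].
  (* The step that writes the sentinel on cell [N] already moves left, so rewinding starts at
     [N.-1]. *)
  have [|T' r R] := @runs_rewind N.-1 (act a T) (leq_pred _).
    move=> i i0 /=; rewrite leq_pred /act ffunE (negbTE i0) (Et i i0).
    split=> //; rewrite /zipper -{1}(prednK N_gt0) rev_iotaS /=.
    have -> : N - N.-1 = 1 by lia.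
    rewrite [iota _ 1]/= prednK // [map _ [:: N]]/= (contentE i N) eqxx.
    by rewrite onth_default //; have -> : (N == 0) = false by lia.
  exists T', N.-1.+2; split=> //; first by lia.
  have -> : (N == 0) = false by lia.
  by apply: runs_step r; rewrite /= /scan ffunE Er drop_size.
move=> nj [[l Er] Et]; have lt : j < N by lia.
have := lt; rewrite -onthTE; case Ea: (onth w j) => [b|] // _.
have Ed : drop j w = b :: drop j.+1 w.
  by rewrite (drop_nth b) // (onth_nth b _ _ _ Ea).
pose a : waction := [ffun i => if i == raw then (scan T i, MoveR)
                  else (Some (inr (j == 0, false, Some b, false)), MoveR)].
have [||T' [u [lu r R]]] := IH j.+1 (act a T); first by lia.
  split.
    by rewrite /act ffunE eqxx Er Ed /scan ffunE Er Ed /=; eexists.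
  move=> i i0; rewrite /act ffunE (negbTE i0) (Et i i0) rev_iotaS /= contentE.
  by rewrite Ea; have -> : (j == N) = false by lia.
exists T', u.+1; split=> //.
apply: runs_step r; rewrite /= /a /scan.
by case: (j == 0); rewrite /= ffunE Er Ed.
Qed.

Lemma runs_init : 0 < N -> exists T u, [/\ u <= N + N.+1,
    runs (M := init) None (raw_input w) u T true
    & rep (fun=> 0, pred0 : pred nat) T].
Proof.
move=> N_gt0; apply: (@runs_copy N 0); rewrite ?addn0 //; split.
  exists [::]; rewrite /raw_input /input_tape eqxx drop0.
  by case: (w) => //= b v; rewrite -map_comp.
by move=> i i0; rewrite /raw_input (negbTE i0).
Qed.

End Correct.

Lemma runs_init_nil : exists T,
  runs (M := init) None (raw_input [::]) 1 T false.
Proof.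
by eexists; apply: runs_exit; rewrite /= /scan ffunE /raw_input eqxx.
Qed.

(** * Polynomial running time *)

Definition poly_bounded (f : nat -> nat) :=
  exists p : {poly nat}, forall n, f n <= p.[n]%R.

Lemma poly_bounded_const c : poly_bounded (fun=> c).
Proof. by exists (c%:P)%R => n; rewrite hornerC. Qed.

Lemma poly_bounded_id : poly_bounded id.
Proof. by exists ('X)%R => n; rewrite hornerX. Qed.

Lemma poly_bounded_add f g :
  poly_bounded f -> poly_bounded g -> poly_bounded (fun n => f n + g n).
Proof.
move=> [p Hp] [q Hq]; exists (p + q)%R => n; rewrite hornerD.
exact: leq_add.
Qed.

Lemma poly_bounded_mul f g :
  poly_bounded f -> poly_bounded g -> poly_bounded (fun n => f n * g n).
Proof.
move=> [p Hp] [q Hq]; exists (p * q)%R => n; rewrite hornerM.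
exact: leq_mul.
Qed.

Lemma poly_bounded_succ : poly_bounded succn.
Proof.
have [p Hp] := poly_bounded_add (poly_bounded_const 1) poly_bounded_id.
by exists p.
Qed.

Ltac poly_bound :=
  repeat first [ apply: poly_bounded_const | apply: poly_bounded_id
    | apply: poly_bounded_succ | apply: poly_bounded_add
    | apply: poly_bounded_mul | assumption ].

Lemma poly_bounded_cost p : poly_bounded (cost p).
Proof. by elim: p => /= *; poly_bound. Qed.

Lemma poly_bounded_decider_cost g p q : poly_bounded (decider_cost g p q).
Proof.
have := (poly_bounded_cost g, poly_bounded_cost p, poly_bounded_cost q).
by case=> -[Hg Hp] Hq; rewrite /decider_cost; poly_bound.
Qed.

Theorem in_P_formula x y g p q (lang : seq symbol -> Prop) :
  wf g -> wf q -> wf (Ex y (Ex x p)) -> ~ lang [::] ->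
  (forall w, 0 < size w -> lang w <->
     eval w pred0 g (fun=> 0) /\
     eval w (rounds (step_eval w x y p) (size w) (size w)) q (fun=> 0)) ->
  in_P lang.
Proof.
move=> wg wq wp lang0 langE.
have [P HP] : poly_bounded (fun n => (n + n.+1) + decider_cost g p q n).
  by have := poly_bounded_decider_cost g p q; poly_bound.
(* The initialisation exits with [false] precisely on the empty word, where there is no position for
   a variable to denote. *)
pose M := branch init (decider x y g p q) (ret false).
exists (tm_of M), P => w.
suff [T [t [b [lt r lb]]]] : exists T t b,
    [/\ t <= P.[size w]%R, runs (mst0 M) (raw_input w) t T b & b <-> lang w].
  exists t, b; split=> //; rewrite /halts_with.
  by have -> := iter_tm_of r.
have [|N0] := posnP (size w).
  move/eqP; rewrite size_eq0 => /eqP ->.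
  have [T r] := runs_init_nil.
  have r1 : runs (M := ret false) tt T 1 (act (moves pred0 pred0 (scan T)) T) false.
    exact: runs_exit.
  exists (act (moves pred0 pred0 (scan T)) T), (1 + 1), false; split=> //.
    by apply: leq_trans (HP _); rewrite /decider_cost; lia.
  exact: runs_branch1 r r1.
have [T [u [lu r R]]] := runs_init N0.
have [s' [/(_ T R)[T' [u' [lu' r' R']]]]] := does_decider N0 wg wq wp.
exists T', (u + u'), (eval w pred0 g (fun=> 0) &&
     eval w (rounds (step_eval w x y p) (size w) (size w)) q (fun=> 0)).
split; first by apply: leq_trans (HP _); apply: leq_add.
  exact: runs_branch1 r r'.
by rewrite langE //; split=> [/andP//|[-> ->]].
Qed.

(** * Meaning of formulas; positions of the items of a word *)

Definition v0 : tapeno := @Ordinal 12 3 isT.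
Definition v1 : tapeno := @Ordinal 12 4 isT.
Definition v2 : tapeno := @Ordinal 12 5 isT.
Definition v3 : tapeno := @Ordinal 12 6 isT.
Definition v4 : tapeno := @Ordinal 12 7 isT.
Definition v5 : tapeno := @Ordinal 12 8 isT.
Definition v6 : tapeno := @Ordinal 12 9 isT.
Definition v7 : tapeno := @Ordinal 12 10 isT.
Definition v8 : tapeno := @Ordinal 12 11 isT.

Definition Or p q := Neg (And (Neg p) (Neg q)).
Definition Imp p q := Neg (And p (Neg q)).
Definition All x p := Neg (Ex x (Neg p)).
Definition NumEq x y := And (NumLe x y) (NumLe y x).
Definition Adj x y := And (Before x y) (And (Neg (Sym Tick y))
  (Neg (Ex v8 (And (And (Before x v8) (Before v8 y)) (Neg (Sym Tick v8)))))).
Definition First x := Neg (Ex v8 (Before v8 x)).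

(* Position [j] holds the first symbol other than [Tick] after position [i]. *)
Definition adj (w : seq symbol) (i j : nat) : Prop :=
  [/\ i < j, onth w j <> Some Tick &
      forall k, k < size w -> i < k < j -> onth w k = Some Tick].

Section Reflect.

Variables (w : seq symbol) (mk : pred nat).
Implicit Types (e : env) (x y : tapeno).
Notation N := (size w).
Notation eval := (eval w mk).

Lemma SymP s x e : reflect (onth w (e x) = Some s) (eval (Sym s x) e).
Proof. exact: eqP. Qed.

Lemma BeforeP x y e : reflect (e x < e y) (eval (Before x y) e).
Proof. exact: idP. Qed.

Lemma MarkedP x e : reflect (mk (e x)) (eval (Marked x) e).
Proof. exact: idP. Qed.

Lemma NumLeP x y e : reflect (num w (e x) <= num w (e y)) (eval (NumLe x y) e).
Proof. exact: idP. Qed.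

Lemma NumEqP x y e : reflect (num w (e x) = num w (e y)) (eval (NumEq x y) e).
Proof. by rewrite /NumEq /= -eqn_leq; apply: eqP. Qed.

(** The reading lemmas follow the syntax one connective at a time, so that the meaning of a large
    formula can be derived by proof search. *)
Lemma NegP P p e : reflect P (eval p e) -> reflect (~ P) (eval (Neg p) e).
Proof. by move=> H /=; apply: (iffP negP) => H' /H. Qed.

Lemma AndP P Q p q e : reflect P (eval p e) -> reflect Q (eval q e) ->
  reflect (P /\ Q) (eval (And p q) e).
Proof. by move=> H H'; apply: (iffP andP) => -[/H ? /H' ?]. Qed.

Lemma OrP P Q p q e : reflect P (eval p e) -> reflect Q (eval q e) ->
  reflect (P \/ Q) (eval (Or p q) e).
Proof.
rewrite /Or /= negb_and !negbK => H H'.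
by apply: (iffP orP) => -[/H|/H'] ?; [left|right|left|right].
Qed.

Lemma ImpP P Q p q e : reflect P (eval p e) -> reflect Q (eval q e) ->
  reflect (P -> Q) (eval (Imp p q) e).
Proof.
rewrite /Imp /= negb_and negbK -implybE => H H'.
by apply: (iffP implyP) => Hi /H/Hi/H'.
Qed.

Lemma ExP (P : nat -> Prop) x p e :
  (forall n, reflect (P n) (eval p (upd e x n))) ->
  reflect (exists2 n, n < N & P n) (eval (Ex x p) e).
Proof.
move=> H; apply: (iffP hasP) => [[n]|[n lt /H Pn]].
  by rewrite mem_iota => lt /H Pn; exists n.
by exists n => //; rewrite mem_iota.
Qed.

Lemma AllP (P : nat -> Prop) x p e :
  (forall n, reflect (P n) (eval p (upd e x n))) ->
  reflect (forall n, n < N -> P n) (eval (All x p) e).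
Proof.
move=> H; rewrite /All /= -all_predC.
apply: (iffP allP) => [Ha n lt|Ha n].
  by apply/H; move: (Ha n); rewrite mem_iota /= negbK; apply.
by rewrite mem_iota /= negbK => lt; apply/H/Ha.
Qed.

Lemma AdjP x y e : x != v8 -> y != v8 ->
  reflect (adj w (e x) (e y)) (eval (Adj x y) e).
Proof.
move=> x8 y8; have H := AndP (BeforeP x y e) (AndP (NegP (SymP Tick y e)) (NegP
  (ExP (fun n => AndP (AndP (BeforeP x v8 (upd e v8 n)) (BeforeP v8 y (upd e v8 n)))
     (NegP (SymP Tick v8 (upd e v8 n))))))).
apply: (iffP H) => [[lt [nt Hk]]|[lt nt Hk]]; split=> //.
  move=> k kN /andP[l1 l2]; apply/eqP/negPn/negP => /eqP ne; apply: Hk.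
  by exists k => //; rewrite /upd eqxx (negbTE x8) (negbTE y8).
split=> // -[k kN]; rewrite /upd eqxx (negbTE x8) (negbTE y8) => -[[l1 l2]].
by apply; apply: Hk => //; rewrite l1.
Qed.

Lemma FirstP x e : x != v8 ->
  reflect (forall k, k < N -> e x <= k) (eval (First x) e).
Proof.
move=> x8; apply: (iffP (NegP (ExP (fun n => BeforeP v8 x (upd e v8 n))))).
  move=> H k kN; rewrite leqNgt; apply/negP => lt; apply: H; exists k => //.
  by rewrite /upd eqxx (negbTE x8).
move=> H [k kN]; rewrite /upd eqxx (negbTE x8) => lt.
by have := H k kN; rewrite leqNgt lt.
Qed.

End Reflect.

(** * Words as lists of items *)

Fixpoint enc_items (n : nat) (its : seq (symbol * nat)) : seq symbol :=
  unary n ++ if its is it :: its then it.1 :: enc_items it.2 its else [::].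

(* Position of the symbol introducing the [k]-th item. *)
Fixpoint pos (n : nat) (its : seq (symbol * nat)) (k : nat) : nat :=
  if its is it :: its then if k is k.+1 then n.+1 + pos it.2 its k else n else n.

Definition delims (its : seq (symbol * nat)) := all (fun it => it.1 != Tick) its.

Lemma enc_itemsE n its : enc_items n its =
  unary n ++ flatten [seq it.1 :: unary it.2 | it <- its].
Proof. by elim: its n => [|it its IH] n //=; rewrite IH. Qed.

(** Thanks to this, statements about positions of an arbitrary word, well-formed or not, become
    statements about a list of pairs. *)
Lemma enc_items_surj w : exists n its, delims its /\ w = enc_items n its.
Proof.
elim: w => [|a w [n [its [d ->]]]]; first by exists 0, [::].
have [->|ne] := eqVneq a Tick; last first.
  by exists 0, ((a, n) :: its); split=> //; rewrite /delims /= ne.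
by exists n.+1, its; split=> //; case: (its).
Qed.

Lemma drop_enc n it its i :
  drop (n.+1 + i) (enc_items n (it :: its)) = drop i (enc_items it.2 its).
Proof.
rewrite drop_cat size_nseq; have -> : (n.+1 + i < n) = false by lia.
by have -> : n.+1 + i - n = i.+1 by lia.
Qed.

Lemma onth_drop (T : Type) (s : seq T) i j : onth (drop i s) j = onth s (i + j).
Proof. by rewrite !onthE map_drop nth_drop. Qed.

Lemma onth_enc n it its i :
  onth (enc_items n (it :: its)) (n.+1 + i) = onth (enc_items it.2 its) i.
Proof. by rewrite -(drop0 (enc_items it.2 its)) -(drop_enc n) onth_drop addn0. Qed.

Lemma num_enc n it its i :
  num (enc_items n (it :: its)) (n.+1 + i) = num (enc_items it.2 its) i.
Proof. by rewrite /num -addnS drop_enc. Qed.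

Lemma onth_enc_lt n its i : i < n -> onth (enc_items n its) i = Some Tick.
Proof. by case: its => [|it its] lt; rewrite onth_cat size_nseq lt onth_nseq lt. Qed.

Lemma onth_enc_at n it its : onth (enc_items n (it :: its)) n = Some it.1.
Proof. by rewrite onth_cat size_nseq ltnn subnn. Qed.

Lemma size_enc n it its :
  size (enc_items n (it :: its)) = n.+1 + size (enc_items it.2 its).
Proof. by rewrite size_cat size_nseq /= addSnnS. Qed.

Lemma find_enc n its : delims its -> find (predC1 Tick) (enc_items n its) = n.
Proof.
rewrite enc_itemsE find_cat has_nseq /= andbF size_nseq.
by case: its => [|it its] //=; rewrite ?addn0 // => /andP[/= -> _]; rewrite addn0.
Qed.

Lemma num_head n its : delims its -> num (enc_items n.+1 its) 0 = n.
Proof.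
move=> d; rewrite -[RHS](find_enc n d) /num !enc_itemsE drop_cat size_nseq /=.
by case: n => [|n]; rewrite /= ?drop0.
Qed.

Lemma pos_onth n its k it : delims its -> onth its k = Some it ->
  [/\ pos n its k < size (enc_items n its),
      onth (enc_items n its) (pos n its k) = Some it.1
    & num (enc_items n its) (pos n its k) = it.2].
Proof.
elim: its n k => [|it' its IH] n [|k] //.
  case/andP=> _ d [<-]; rewrite size_enc onth_enc_at; split=> //; first exact: leq_addr.
  by rewrite /num -[n.+1]addn0 drop_enc drop0 find_enc.
case/andP=> _ d /(IH it'.2 _ d)[lt Eo En].
by rewrite size_enc [pos _ _ _]/= onth_enc num_enc; split=> //; lia.
Qed.

Lemma onth_pos n its i : i < size (enc_items n its) ->
  onth (enc_items n its) i <> Some Tick ->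
  exists k it, onth its k = Some it /\ i = pos n its k.
Proof.
elim: its n i => [|it its IH] n i.
  by rewrite /= cats0 size_nseq => lt; rewrite onth_nseq lt.
rewrite size_enc; case: (ltngtP i n) => [lt _|gt lt|-> _ _].
- by rewrite onth_enc_lt.
- rewrite -(subnKC gt) onth_enc => /IH[|k [it' [Eo Ei]]]; first by lia.
  by exists k.+1, it'; rewrite Ei.
- by exists 0, it.
Qed.

Lemma ltn_pos n its k l : k < l < size its -> pos n its k < pos n its l.
Proof.
elim: its n k l => [|it its IH] n k l; first by rewrite andbF.
case: k l => [|k] [|l] //; rewrite [pos _ _ l.+1]/= [pos _ _ _]/= => kl; first lia.
by rewrite ltn_add2l; apply: IH.
Qed.

Section Positions.

Variables (n : nat) (its : seq (symbol * nat)).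
Hypothesis d : delims its.
Notation w := (enc_items n its).
Notation pos := (pos n its).

Lemma pos_nontick k it : onth its k = Some it -> onth w (pos k) <> Some Tick.
Proof.
move=> E; have [_ -> _] := pos_onth n d E; case=> E1.
have itin : it \in its by apply/onthP; exists k.
by move/allP: d => /(_ it itin); rewrite E1.
Qed.

Lemma ltn_pos_inv k l : k < size its -> l < size its -> pos k < pos l -> k < l.
Proof.
move=> kS lS lt; case: (ltngtP k l) => // [lk|E]; last by rewrite E ltnn in lt.
have : pos l < pos k by apply: ltn_pos; rewrite lk.
by lia.
Qed.

Lemma adj_posE k it j : onth its k = Some it -> j < size w ->
  adj w (pos k) j <-> exists2 it', onth its k.+1 = Some it' & j = pos k.+1.
Proof.
move=> Ek jN; have kS : k < size its by rewrite -onthTE Ek.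
have lS l it' : onth its l = Some it' -> l < size its by rewrite -onthTE => ->.
have nt := pos_nontick.
split=> [[lt ne Hk]|[it' E' ->]].
  have [l [it' [El Ej]]] := onth_pos jN ne; subst j.
  have kl := ltn_pos_inv kS (lS _ _ El) lt.
  have [E|ltl] : k.+1 = l \/ k.+1 < l by lia.
    by exists it'; rewrite ?E.
  have kS' : k.+1 < size its by apply: ltn_trans ltl (lS _ _ El).
  have := kS'; rewrite -onthTE; case E1: (onth its k.+1) => [it1|] // _.
  case: (nt _ _ E1); apply: Hk; first by case: (pos_onth n d E1).
  by rewrite !ltn_pos // ?ltl ?ltnSn ?kS' ?(lS _ _ El).
have kS' := lS _ _ E'.
split; first by apply: ltn_pos; rewrite ltnSn.
  exact: nt E'.
move=> i iN /andP[l1 l2]; apply/eqP/negPn/negP => /eqP ne.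
have [r [it2 [Er Ei]]] := onth_pos iN ne; subst i.
have := ltn_pos_inv kS (lS _ _ Er) l1; have := ltn_pos_inv (lS _ _ Er) kS' l2.
by lia.
Qed.

Lemma adj_headE j : 0 < n -> j < size w ->
  adj w 0 j <-> exists2 it, onth its 0 = Some it & j = n.
Proof.
move=> n0 jN; have E0 it : onth its 0 = Some it -> pos 0 = n by case: (its).
have lS l it' : onth its l = Some it' -> l < size its by rewrite -onthTE => ->.
have nt := pos_nontick.
split=> [[lt ne Hk]|[it E ->]].
  have [[|l] [it' [El Ej]]] := onth_pos jN ne; subst j.
    by exists it' => //; apply: E0 El.
  have S0 : 0 < size its by apply: leq_ltn_trans (lS _ _ El).
  have := S0; rewrite -onthTE; case E1: (onth its 0) => [it1|] // _.
  case: (nt _ _ E1); apply: Hk; first by case: (pos_onth n d E1).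
  by rewrite ltn_pos ?(lS _ _ El) // (E0 _ E1) n0.
split=> //; first by rewrite -{2}(E0 _ E); apply: nt E.
by move=> i iN /andP[_ lt]; apply: onth_enc_lt.
Qed.

End Positions.

(** * Bipolar frameworks *)

Section Bipolar.

Variables (L : finType) (F : aba L).
Hypothesis bip : bipolar F.
Implicit Types (A B : {set L}) (a b c h x y : L).

Definition step_rel : rel L := fun b h => (h, [:: b]) \in rules F.
Definition asm_step : rel L := fun b h => step_rel b h && (h \in asm F).
(** The contrary map as a relation on sentences, free of the membership proofs carried by its
    domain. *)
Definition has_contrary a c : bool :=
  [exists b : {x : L | x \in asm F}, (val b == a) && (contrary b == c)].
Definition direct A c : bool := (c \in A) || [exists b in A, step_rel b c].
Definition attacked A y : bool := [exists c, has_contrary y c && direct A c].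
(* Some assumption reachable from [x] is attacked by [A], i.e. [A] attacks the
   closure of [x]. *)
Definition countered A x : bool := [exists y, attacked A y && connect asm_step x y].
Definition step_closed A :=
  forall b h, b \in A -> h \in asm F -> step_rel b h -> h \in A.

Lemma step_rel_asm b h : step_rel b h -> b \in asm F.
Proof. by case/bip => a aF [[->]]. Qed.

(** Bodies are singletons, so every inner node has one child, labelled by an assumption and not by
    [None]: the tree is a path, and its leaf is the starting vertex. *)
Lemma wf_connect t phi : tree_wf F t -> label t = Some phi ->
  exists2 x, x \in leaf_asms t & x \in asm F /\ connect step_rel x phi.
Proof.
move: t phi; fix IH 1 => -[[h|] [|t ts]] phi //.
  by move=> aF [<-]; exists h; rewrite ?mem_seq1.
move=> /= /andP[/hasP[r rF /andP[/eqP rh]]].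
have [a aF [Er _]] := bip rF; rewrite Er => /eqP[lt].
case: ts => // _ /andP[wt _] [<-].
have [x xt [xF xa]] := IH t a wt lt.
exists x; first by rewrite cats0.
split=> //; apply: connect_trans xa (connect1 _).
by rewrite /step_rel -Er -rh -surjective_pairing.
Qed.

Lemma connect_tree x y : x \in asm F -> connect step_rel x y ->
  exists t, [/\ label t = Some y, tree_wf F t, leaf_asms t = [:: x]
    & {subset used_rules t <= rules F}].
Proof.
(* The last rule of the path is the one applied at the root, hence induction from the end of the
   path. *)
move=> xF /connectP[p]; elim/last_ind: p y => [|p z IH] y.
  by move=> _ ->; exists (Node (Some x) [::]).
rewrite rcons_path last_rcons => /andP[pp st] ->.
have [t [lt wt xt rt]] := IH _ pp erefl.
exists (Node (Some z) [:: t]); split=> //=.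
- rewrite wt /= andbT; apply/hasP; exists (z, [:: last x p]) => //=.
  by rewrite lt !eqxx.
- by rewrite xt.
- by move=> r; rewrite cats0 lt inE => /predU1P[->|/rt].
Qed.

Lemma derivesE B phi : derives F B phi <->
  exists2 x, x \in B & x \in asm F /\ connect step_rel x phi.
Proof.
split=> [[A [R [AB _ [t [lt wt At _]]]]]|[x xB [xF xp]]].
  have [x xt xF] := wf_connect wt lt; exists x => //.
  by apply: (subsetP AB); rewrite At.
have [t [lt wt xt rt]] := connect_tree xF xp.
exists [set x], (used_rules t); split; rewrite ?sub1set //.
by exists t; split=> // y; rewrite xt !inE.
Qed.

Lemma direct_derives A c : A \subset asm F -> direct A c -> derives F A c.
Proof.
move=> AF /orP[cA|/existsP[b /andP[bA st]]]; apply/derivesE.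
  by exists c => //; split=> //; apply: (subsetP AF).
by exists b => //; split; [apply: (subsetP AF) | apply: connect1].
Qed.

(** Inner vertices of a derivation path are bodies of rules, hence assumptions, so the path cannot
    leave a step-closed set before its last step. *)
Lemma derives_direct A c : step_closed A -> derives F A c -> direct A c.
Proof.
move=> clA /derivesE[x xA [xF /connectP[p]]].
elim: p x xA xF => [|y p IH] x xA xF /=; first by move=> _ ->; rewrite /direct xA.
move=> /andP[st]; case: p IH => [|z p] IH pp Ec.
  by rewrite /direct Ec; apply/orP; right; apply/existsP; exists x; rewrite xA.
have yF : y \in asm F by case/andP: pp => /step_rel_asm.
by apply: (IH y) => //; apply: clA st.
Qed.

Lemma closedE A : A \subset asm F -> Defs.closed F A <-> step_closed A.
Proof.
move=> AF; split=> [clA b h bA hF st|clA a].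
  apply/clA; split=> //; apply/derivesE; exists b => //.
  by split; [apply: (subsetP AF) | apply: connect1].
split=> [aA|[aF /(derives_direct clA)]].
  by split; [apply: (subsetP AF) | apply: direct_derives => //; rewrite /direct aA].
by case/orP=> // /existsP[b /andP[bA]]; apply: clA.
Qed.

Lemma attacksE A B : A \subset asm F -> step_closed A ->
  attacks F A B <-> exists2 y, y \in B & attacked A y.
Proof.
move=> AF clA; split=> [[b bB /(derives_direct clA) dc]|[y yB]].
  exists (val b) => //; apply/existsP; exists (contrary b); rewrite dc andbT.
  by apply/existsP; exists b; rewrite !eqxx.
case/existsP=> c /andP[/existsP[b /andP[/eqP Eb /eqP Ec]] dc].
by exists b; rewrite ?Eb // Ec; apply: direct_derives.
Qed.

Lemma step_closed_connect B x y :
  step_closed B -> x \in B -> connect asm_step x y -> y \in B.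
Proof.
move=> clB xB /connectP[p]; elim: p x xB => [|z p IH] x xB /= => [_ -> //|].
by case/andP=> /andP[st zF]; apply: IH; apply: clB st.
Qed.

(* A closed attacker of [A] contains an assumption [x] attacking [A] by at most
   one rule, and contains the closure of [x]; so only the closures of such
   single assumptions have to be attacked. *)
Lemma admissibleE A : A \subset asm F -> admissible F A <->
  [/\ step_closed A,
      forall a c, has_contrary a c -> a \in A -> ~~ direct A c
    & forall x a c, x \in asm F -> ~~ countered A x -> has_contrary a c ->
        a \in A -> c <> x /\ ~~ step_rel x c].
Proof.
move=> AF; split=> [[/(closedE AF) clA cf df]|[clA cf df]].
  split=> // [a c ac aA|x a c xF nx ac aA].
    apply/negP => dc; apply: cf; apply/attacksE => //; exists a => //.
    by apply/existsP; exists c; rewrite ac.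
  suff H : ~ (c = x \/ step_rel x c).
    by split; [move=> E; apply: H; left | apply/negP => E; apply: H; right].
  move=> xc; move/negP: nx; apply.
  pose B := [set z in asm F | connect asm_step x z].
  have BF : B \subset asm F by apply/subsetP => z; rewrite inE => /andP[].
  have clB : step_closed B.
    move=> b h; rewrite !inE => /andP[bF xb] hF st; rewrite hF /=.
    by apply: connect_trans xb (connect1 _); rewrite /asm_step st.
  have xB : x \in B by rewrite inE xF connect0.
  have BA : attacks F B [set a].
    apply/attacksE => //; exists a; rewrite ?inE //.
    apply/existsP; exists c; rewrite ac; apply/orP.
    case: xc => [->|st]; [by left | right].
    by apply/existsP; exists x; rewrite xB.
  have := df a aA B BF (proj2 (closedE BF) clB) BA.
  case/(attacksE _ AF clA) => y; rewrite inE => /andP[_ xy] ay.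
  by apply/existsP; exists y; rewrite ay.
split; first exact/closedE.
  case/(attacksE _ AF clA) => a aA /existsP[c /andP[ac]].
  by move=> dc; move: (cf a c ac aA); rewrite dc.
move=> a aA B BF /(closedE BF) clB /(attacksE _ BF clB)[_ /set1P ->].
case/existsP=> c /andP[ac dc]; apply/attacksE => //.
have [x xB xc] : exists2 x, x \in B & c = x \/ step_rel x c.
  by case/orP: dc => [cB|/existsP[x /andP[xB st]]]; [exists c | exists x] => //; auto.
have xF := subsetP BF x xB.
have [/existsP[y /andP[ay xy]]|nx] := boolP (countered A x).
  by exists y => //; apply: step_closed_connect xy.
have [ne nst] := df x a c xF nx ac aA.
by case: xc => // st; rewrite st in nst.
Qed.

End Bipolar.

(** * The formulas deciding admissibility *)

(* [leaf] comes before the connectives, since a named formula is convertible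
   to a quantified one. *)
Ltac reflect_formula leaf := repeat first
  [ leaf | exact: SymP | exact: BeforeP | exact: MarkedP | exact: NumLeP
  | exact: NumEqP | exact: AdjP | exact: FirstP
  | apply: NegP | apply: AndP | apply: OrP | apply: ImpP
  | apply: ExP => ? | apply: AllP => ? ].

(** The auxiliary formulas [In_A], [Is_asm], [Pair] and [Direct] bind only variables among [v5] to
    [v8], which leaves [v0] to [v4] for the conditions built from them. *)
Definition In_A x := Ex v7 (And (Sym SMember v7) (NumEq x v7)).
Definition Is_asm x := Ex v7 (And (Sym SAsm v7) (NumEq x v7)).
Definition Pair s x y := And (Sym s x) (Adj x y).
Definition Direct y := Or (In_A y)
  (Ex v5 (Ex v6 (And (Pair SHead v5 v6) (And (NumEq v5 y) (In_A v6))))).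

Definition Closed_A := All v0 (All v1
  (Imp (And (Pair SHead v0 v1) (And (In_A v1) (Is_asm v0))) (In_A v0))).
Definition Conflict_free_A := All v0 (All v1
  (Imp (And (Pair SAsm v0 v1) (In_A v0)) (Neg (Direct v1)))).

(* One step of the computation of the assumptions whose closure is attacked by
   the candidate extension. *)
Definition Step := And (Sym SAsm v0) (Or
  (Ex v2 (Ex v3 (And (Pair SAsm v2 v3) (And (NumEq v2 v0) (Direct v3)))))
  (Ex v2 (Ex v3 (And (Pair SHead v2 v3) (And (NumEq v3 v0)
     (Ex v4 (And (Sym SAsm v4) (And (NumEq v4 v2) (Marked v4))))))))).

Definition Defended := All v0 (Imp (And (Sym SAsm v0) (Neg (Marked v0)))
  (All v2 (All v3 (Imp (And (Pair SAsm v2 v3) (In_A v2))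
     (And (Neg (NumEq v3 v0))
        (Neg (Ex v5 (Ex v6 (And (Pair SHead v5 v6)
           (And (NumEq v5 v3) (NumEq v6 v0))))))))))).

(** The transitions of an automaton on the delimiters, with [Tick] standing for the leading number.
    Only [SAsm] may follow that number, as there is an assumption; the rule block and the member
    block may be empty; a head is followed by exactly one body element. *)
Definition consecutive : seq (symbol * symbol) :=
  [:: (Tick, SAsm); (SAsm, SContrary); (SContrary, SAsm); (SContrary, SHead);
      (SContrary, SMember); (SHead, SBody); (SBody, SHead); (SBody, SMember);
      (SMember, SMember)].

Definition Syms (st : symbol * symbol) := And (Sym st.1 v0) (Sym st.2 v1).
Definition Consecutive := foldr (fun st p => Or (Syms st) p)
  (And (Sym Tick v0) (Neg (Sym Tick v0))) consecutive.

(** All pairs of positions are compared, since items with the same symbol need not be neighbours. *)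
Definition Increasing s := All v0 (All v1
  (Imp (And (Before v0 v1) (And (Sym s v0) (Sym s v1))) (Neg (NumLe v1 v0)))).

(** Beyond the shape of the word, this checks that numbers denote sentences, that the assumptions
    and the members are listed in order, that members are assumptions, and that the rules are
    bipolar. Rules are subject to no order, because a framework lists them as an arbitrary
    sequence. *)
Definition Well_formed :=
  And (Ex v0 (Ex v1 (And (And (First v0) (Sym Tick v0))
                         (And (Adj v0 v1) (Sym SAsm v1)))))
 (And (All v0 (All v1 (Imp (And (Neg (Sym Tick v0)) (Adj v0 v1)) Consecutive)))
 (And (All v0 (Imp (Or (Sym SAsm v0) (Sym SHead v0)) (Ex v1 (Adj v0 v1))))
 (And (All v0 (All v1 (Imp (And (First v1) (Neg (Sym Tick v0))) (NumLe v0 v1))))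
 (And (Increasing SAsm)
 (And (Increasing SMember)
 (And (All v0 (Imp (Or (Sym SBody v0) (Sym SMember v0)) (Is_asm v0)))
      (All v0 (Imp (Sym SHead v0)
         (Ex v1 (And (Or (Sym SAsm v1) (Sym SContrary v1)) (NumEq v0 v1))))))))))).

(** * Numbers and pairs listed in a word, and the meaning of the formulas *)

Definition vals (s : symbol) (its : seq (symbol * nat)) : seq nat :=
  [seq it.2 | it <- its & it.1 == s].

(** The symbol of the second item is left open, as in [Pair]; in a well-formed word it is forced to
    be [SContrary] after [SAsm] and [SBody] after [SHead]. *)
Fixpoint pairs (s : symbol) (its : seq (symbol * nat)) : seq (nat * nat) :=
  if its is p :: its then
    (if its is q :: _ then if p.1 == s then [:: (p.2, q.2)] else [::] else [::])
    ++ pairs s its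
  else [::].

Lemma mem_vals s its v : (v \in vals s its) = ((s, v) \in its).
Proof.
apply/mapP/idP => [[[s' v'] /=]|H].
  by rewrite mem_filter => /andP[/eqP/= -> H] ->.
by exists (s, v); rewrite // mem_filter eqxx.
Qed.

Lemma mem_pairs s its a b : reflect
  (exists k t, onth its k = Some (s, a) /\ onth its k.+1 = Some (t, b))
  ((a, b) \in pairs s its).
Proof.
elim: its => [|[s1 v1] its IH].
  by apply: (iffP idP) => // -[k [t []]]; rewrite onth0n.
rewrite /= mem_cat; apply: (iffP orP).
  case=> [|/IH[k [t H]]]; last by exists k.+1, t.
  case: its {IH} => [|[s2 v2] its] //; case: eqP => //= ->.
  by rewrite inE => /eqP[-> ->]; exists 0, s2.
case=> -[|k] [t [/= E1 E2]]; last by right; apply/IH; exists k, t.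
left; case: E1 => -> ->; case: its {IH} E2 => [|[s2 v2] its] //= [_ ->].
by rewrite eqxx inE.
Qed.

Section Words.

Variables (n : nat) (its : seq (symbol * nat)).
Hypothesis d : delims its.
Notation w := (enc_items n its).
Notation N := (size w).

Lemma sym_onth i s : i < N -> s != Tick -> onth w i = Some s ->
  exists2 k, onth its k = Some (s, num w i) & i = pos n its k.
Proof.
move=> iN ne E; have [|k [it [Eo Ei]]] := onth_pos iN.
  by rewrite E => -[E']; rewrite E' in ne.
exists k => //; rewrite Eo; have [_ E1 E2] := pos_onth n d Eo.
by move: E; rewrite Ei E1 E2 => -[<-]; rewrite -surjective_pairing.
Qed.

Lemma ex_symP s v : s != Tick ->
  (exists2 i, i < N & onth w i = Some s /\ num w i = v) <-> v \in vals s its.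
Proof.
move=> ne; rewrite mem_vals; split=> [[i iN [Es <-]]|/onthP[k Ek]].
  by have [k Ek _] := sym_onth iN ne Es; apply/onthP; exists k.
by have [lt Es Ev] := pos_onth n d Ek; exists (pos n its k).
Qed.

Lemma ex_pairP s a b : s != Tick ->
  (exists i j, [/\ i < N, j < N, onth w i = Some s /\ adj w i j,
     num w i = a & num w j = b]) <-> (a, b) \in pairs s its.
Proof.
move=> ne; split=> [[i [j [iN jN [Es ad] <- <-]]]|/mem_pairs[k [t [E1 E2]]]].
  have [k Ek Ei] := sym_onth iN ne Es; move: ad; rewrite {1}Ei.
  case/(adj_posE d Ek jN) => -[t v] E2 Ej; apply/mem_pairs; exists k, t.
  by split=> //; rewrite E2 Ej; have [_ _ ->] := pos_onth n d E2.
have [l1 Es1 Ev1] := pos_onth n d E1; have [l2 Es2 Ev2] := pos_onth n d E2.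
exists (pos n its k), (pos n its k.+1); split=> //; split=> //.
by apply/(adj_posE d E1 l2); exists (t, b).
Qed.

Variable mk : pred nat.
Notation eval := (eval w mk).
Implicit Types (e : env) (x y : tapeno).

Definition directN (c : nat) : Prop :=
  c \in vals SMember its \/
  exists2 b, (c, b) \in pairs SHead its & b \in vals SMember its.

Lemma PairP s x y e : x != v8 -> y != v8 ->
  reflect (onth w (e x) = Some s /\ adj w (e x) (e y)) (eval (Pair s x y) e).
Proof. by move=> x8 y8; apply: AndP; [apply: SymP | apply: AdjP]. Qed.

Lemma In_AP x e : x != v7 ->
  reflect (num w (e x) \in vals SMember its) (eval (In_A x) e).
Proof.
move=> x7; apply: (iffP (ExP (fun k => AndP (SymP w mk SMember v7 (upd e v7 k))
   (NumEqP w mk x v7 (upd e v7 k))))); rewrite /upd eqxx (negbTE x7).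
  by case=> i iN [Es Ev]; apply/ex_symP => //; exists i.
by case/ex_symP => // i iN [Es Ev]; exists i.
Qed.

Lemma Is_asmP x e : x != v7 ->
  reflect (num w (e x) \in vals SAsm its) (eval (Is_asm x) e).
Proof.
move=> x7; apply: (iffP (ExP (fun k => AndP (SymP w mk SAsm v7 (upd e v7 k))
   (NumEqP w mk x v7 (upd e v7 k))))); rewrite /upd eqxx (negbTE x7).
  by case=> i iN [Es Ev]; apply/ex_symP => //; exists i.
by case/ex_symP => // i iN [Es Ev]; exists i.
Qed.

Ltac reflect_eval :=
  reflect_formula ltac:(first [exact: PairP | exact: In_AP | exact: Is_asmP]).

Lemma DirectP y e : y \notin [:: v5; v6; v7; v8] ->
  reflect (directN (num w (e y))) (eval (Direct y) e).
Proof.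
rewrite !inE !negb_or => /and4P[y5 y6 y7 y8].
have H : reflect (num w (e y) \in vals SMember its \/
    exists2 i, i < N & exists2 j, j < N & (onth w i = Some SHead /\ adj w i j) /\
      (num w i = num w (e y) /\ num w j \in vals SMember its)) (eval (Direct y) e).
  apply: OrP; first exact: In_AP.
  apply: ExP => i; apply: ExP => j.
  have -> : num w (e y) = num w (upd (upd e v5 i) v6 j y).
    by rewrite /upd (negbTE y5) (negbTE y6).
  by reflect_eval.
apply: (iffP H) => [[?|[i iN [j jN [ij [<- jA]]]]]|[?|[b]]]; try by left.
  by right; exists (num w j) => //; apply/ex_pairP => //; exists i, j.
case/ex_pairP => // i [j [iN jN ij Ei Ej]] bA; right.
by exists i => //; exists j => //; rewrite Ei Ej.
Qed.

Definition attackedN (v : nat) : Prop :=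
  exists2 c, (v, c) \in pairs SAsm its & directN c.

Lemma Closed_AP : reflect
  (forall h b, (h, b) \in pairs SHead its -> b \in vals SMember its ->
     h \in vals SAsm its -> h \in vals SMember its)
  (eval Closed_A (fun=> 0)).
Proof.
have H : reflect (forall i, i < N -> forall j, j < N ->
    (onth w i = Some SHead /\ adj w i j) /\
    num w j \in vals SMember its /\ num w i \in vals SAsm its ->
    num w i \in vals SMember its) (eval Closed_A (fun=> 0)).
  by rewrite /Closed_A; reflect_eval.
apply: (iffP H) => {}H.
  move=> h b /ex_pairP[] // i [j [iN jN ij <- <-]] jA hF.
  exact: H jN (conj ij (conj jA hF)).
move=> i iN j jN [ij [jA iF]]; apply: H jA iF.
by apply/ex_pairP => //; exists i, j.
Qed.

Lemma Conflict_free_AP : reflect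
  (forall a c, (a, c) \in pairs SAsm its -> a \in vals SMember its -> ~ directN c)
  (eval Conflict_free_A (fun=> 0)).
Proof.
have H : reflect (forall i, i < N -> forall j, j < N ->
    (onth w i = Some SAsm /\ adj w i j) /\ num w i \in vals SMember its ->
    ~ directN (num w j)) (eval Conflict_free_A (fun=> 0)).
  rewrite /Conflict_free_A; apply: AllP => i; apply: AllP => j; apply: ImpP.
    by reflect_eval.
  by apply: NegP; apply: (DirectP (y := v1)).
apply: (iffP H) => {}H.
  move=> a c /ex_pairP[] // i [j [iN jN ij <- <-]] iA.
  exact: H jN (conj ij iA).
move=> i iN j jN [ij iA]; apply: H iA.
by apply/ex_pairP => //; exists i, j.
Qed.

Lemma StepP i k : reflect
  (onth w i = Some SAsm /\ (attackedN (num w i) \/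
     exists h, (h, num w i) \in pairs SHead its /\
       exists2 z, z < N & [/\ onth w z = Some SAsm, num w z = h & mk z]))
  (step_eval w v0 v1 Step k mk i).
Proof.
have H : reflect (onth w i = Some SAsm /\
    ((exists2 j, j < N & exists2 l, l < N & (onth w j = Some SAsm /\ adj w j l) /\
       (num w j = num w i /\ directN (num w l))) \/
     (exists2 j, j < N & exists2 l, l < N & (onth w j = Some SHead /\ adj w j l) /\
       (num w l = num w i /\ exists2 z, z < N &
          onth w z = Some SAsm /\ (num w z = num w j /\ mk z)))))
    (step_eval w v0 v1 Step k mk i).
  rewrite /step_eval /Step; apply: AndP; first exact: SymP.
  apply: OrP; last by reflect_eval.
  apply: ExP => j; apply: ExP => l; apply: AndP; first by reflect_eval.
  by apply: AndP; [reflect_eval | apply: (DirectP (y := v3))].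
apply: (iffP H) => -[Ei Hi]; split=> //.
  case: Hi => [[j jN [l lN [jl [<- dl]]]]|[j jN [l lN [jl [<- [z zN [Ez [Ej mz]]]]]]]].
    by left; exists (num w l) => //; apply/ex_pairP => //; exists j, l.
  right; exists (num w j); split; last by exists z.
  by apply/ex_pairP => //; exists j, l.
case: Hi => [[c /ex_pairP[] // j [l [jN lN jl Ej El]] dc]|[h [/ex_pairP[] //]]].
  by left; exists j => //; exists l => //; rewrite Ej El.
move=> j [l [jN lN jl Ej El]] [z zN [Ez Ezh mz]].
by right; exists j => //; exists l => //; rewrite El Ej; do !split=> //; exists z.
Qed.

Lemma DefendedP : reflect
  (forall i, i < N -> onth w i = Some SAsm -> ~ mk i ->
     forall a c, (a, c) \in pairs SAsm its -> a \in vals SMember its ->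
       c <> num w i /\ (c, num w i) \notin pairs SHead its)
  (eval Defended (fun=> 0)).
Proof.
have H : reflect (forall i, i < N -> onth w i = Some SAsm /\ ~ mk i ->
    forall j, j < N -> forall l, l < N ->
    (onth w j = Some SAsm /\ adj w j l) /\ num w j \in vals SMember its ->
    num w l <> num w i /\ ~ (exists2 r, r < N & exists2 s, s < N &
      (onth w r = Some SHead /\ adj w r s) /\
      (num w r = num w l /\ num w s = num w i))) (eval Defended (fun=> 0)).
  by rewrite /Defended; reflect_eval.
apply: (iffP H) => {}H.
  move=> i iN Ei mi a c /ex_pairP[] // j [l [jN lN jl <- <-]] jA.
  have [ne nr] := H i iN (conj Ei mi) j jN l lN (conj jl jA); split=> //.
  apply/negP => /ex_pairP[] // r [s [rN sN rs Er Es]]; apply: nr.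
  by exists r => //; exists s.
move=> i iN [Ei mi] j jN l lN [jl jA].
have jl' : (num w j, num w l) \in pairs SAsm its.
  by apply/ex_pairP => //; exists j, l.
have [ne nr] := H i iN Ei mi _ _ jl' jA; split=> // -[r rN [s sN [rs [Er Es]]]].
by move/negP: nr; apply; apply/ex_pairP => //; exists r, s.
Qed.

End Words.

(** * Well-formed words *)

Definition follows : rel symbol := fun s t => (s, t) \in consecutive.
Definition final_symbols := [:: SContrary; SBody; SMember].

Definition well_formed (n : nat) (its : seq (symbol * nat)) : Prop :=
  (0 < n /\ path follows Tick (unzip1 its) /\
     last Tick (unzip1 its) \in final_symbols) /\
  all (fun it => it.2 < n) its /\
  (sorted ltn (vals SAsm its) /\ sorted ltn (vals SMember its)) /\
  {subset vals SBody its <= vals SAsm its} /\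
  {subset vals SMember its <= vals SAsm its} /\
  {subset vals SHead its <= vals SAsm its ++ vals SContrary its}.

Lemma path_followsE s (its : seq (symbol * nat)) : path follows s (unzip1 its) <->
  (forall p : symbol * nat, onth its 0 = Some p -> follows s p.1) /\
  (forall k p q, onth its k = Some p -> onth its k.+1 = Some q -> follows p.1 q.1).
Proof.
elim: its s => [|p its IH] s; first by split=> // _; split=> [q|k q r]; rewrite onth0n.
rewrite /=; split=> [/andP[sp /IH[H0 H]]|[H0 H]].
  split=> [q [<-] //|[|k] q r]; last exact: H.
  by case=> <-; apply: H0.
rewrite H0 //=; apply/IH; split=> [q|k q r]; first exact: (H 0).
exact: (H k.+1).
Qed.

(** Among the delimiters only [SAsm] and [SHead] are not final, so the condition on the last symbol
    says that each of these has a successor, which a formula can express. *)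
Lemma last_finalE s its : delims its ->
  last s (unzip1 its) \in final_symbols <->
  (its = [::] -> s \in final_symbols) /\
  (forall k p, onth its k = Some p -> p.1 \in [:: SAsm; SHead] -> onth its k.+1).
Proof.
elim: its s => [|p its IH] s; first by move=> _; split=> [fs|[-> //]]; split=> // k p; rewrite onth0n.
move=> /andP[pT d] /=; rewrite (IH p.1 d); split=> -[H0 H]; split=> //.
- move=> [|k] q /=; last exact: H.
  case=> <-; case: its {IH d H} H0 => // /(_ erefl).
  by case: (p.1).
- move=> E; subst its; have := H 0 p erefl; rewrite /= ?onth0n.
  by move: pT; case: (p.1) => //= _ /(_ isT).
- by move=> k q; apply: (H k.+1).
Qed.

Lemma pairwise_filter (T : Type) (a : pred T) (r : rel T) s :
  pairwise (fun x y => a x && a y ==> r x y) s = pairwise r (filter a s).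
Proof.
elim: s => //= x s ->; case: (a x) => /=; last by rewrite all_predT.
by rewrite all_filter.
Qed.

(** By transitivity sortedness is a condition on all pairs, and in that form it commutes with
    discarding the items that carry other symbols. *)
Lemma sorted_valsE s its : sorted ltn (vals s its) <->
  forall k l p q, k < l -> onth its k = Some p -> onth its l = Some q ->
    p.1 = s -> q.1 = s -> p.2 < q.2.
Proof.
rewrite (sorted_pairwise ltn_trans) pairwise_map -pairwise_filter.
pose x0 := (Tick, 0).
have sz k p : onth its k = Some p -> k < size its by rewrite -onthTE => ->.
split=> [/(pairwiseP x0) H k l p q kl Ek El Ep Eq|H].
  have := H k l (sz _ _ Ek) (sz _ _ El) kl.
  by rewrite (onth_nth x0 _ _ _ Ek) (onth_nth x0 _ _ _ El) Ep Eq !eqxx.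
apply/(pairwiseP x0) => k l; rewrite !inE => ks ls kl.
apply/implyP => /andP[/eqP Ep /eqP Eq].
apply: (H k l _ _ kl _ _ Ep Eq).
  by rewrite onthE (nth_map x0).
by rewrite onthE (nth_map x0).
Qed.

Section Words.

Variables (n : nat) (its : seq (symbol * nat)) (mk : pred nat).
Hypothesis d : delims its.
Notation w := (enc_items n its).
Notation N := (size w).
Notation eval := (eval w mk).

Ltac reflect_eval :=
  reflect_formula ltac:(first [exact: PairP | exact: In_AP | exact: Is_asmP]).

Lemma ConsecutiveP e : reflect
  (exists2 st, st \in consecutive & onth w (e v0) = Some st.1 /\ onth w (e v1) = Some st.2)
  (eval Consecutive e).
Proof.
rewrite /Consecutive; elim: consecutive => [|st l IH].
  by rewrite /= andbN; constructor=> -[].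
apply: (iffP (OrP (AndP (SymP _ _ st.1 v0 e) (SymP _ _ st.2 v1 e)) IH)).
  by case=> [H|[st' l' H]]; [exists st | exists st'] => //;
    rewrite inE ?eqxx // l' orbT.
by case=> st'; rewrite inE => /predU1P[->|H] H'; [left | right; exists st'].
Qed.

Lemma headE :
  (exists2 i, i < N & exists2 j, j < N &
     ((forall k, k < N -> i <= k) /\ onth w i = Some Tick) /\
     (adj w i j /\ onth w j = Some SAsm)) <->
  0 < n /\ exists v, onth its 0 = Some (SAsm, v).
Proof.
have pos0 : pos n its 0 = n by case: (its).
split=> [[i iN [j jN [[i0 Ei] [ij Ej]]]]|[n0 [v E0]]].
  have {i0} i0 : i = 0 by apply/eqP; rewrite -leqn0 i0 //; lia.
  subst i; have n0 : 0 < n.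
    have [n0|//] := posnP n; move: iN Ei; rewrite n0.
    case: (its) d => [|it its'] // /andP[itT _] _.
    by rewrite (onth_enc_at 0) => -[E]; rewrite E in itT.
  split=> //; have [[s v] E0 En] := proj1 (adj_headE d n0 jN) ij; exists v.
  have [_ Es _] := pos_onth n d E0; move: Es.
  by subst j; rewrite pos0 Ej E0 => -[->].
have [] := pos_onth n d E0; rewrite pos0 => nN En _.
exists 0; first by lia.
exists n => //; split; split=> //; first exact: onth_enc_lt.
by apply/(adj_headE d n0 nN); exists (SAsm, v).
Qed.

Lemma followsE :
  (forall i, i < N -> forall j, j < N -> onth w i <> Some Tick /\ adj w i j ->
     exists2 st, st \in consecutive & onth w i = Some st.1 /\ onth w j = Some st.2) <->
  forall k p q, onth its k = Some p -> onth its k.+1 = Some q -> follows p.1 q.1.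
Proof.
split=> [H k p q Ep Eq|H i iN j jN [ne ij]].
  have [iN Ei _] := pos_onth n d Ep; have [jN Ej _] := pos_onth n d Eq.
  have [|st stc] := H _ iN _ jN.
    split; first exact: (pos_nontick d Ep).
    by apply/(adj_posE d Ep jN); exists q.
  rewrite Ei Ej => -[[E1] [E2]].
  by rewrite /follows E1 E2 -surjective_pairing.
have [k [p [Ep Ei]]] := onth_pos iN ne; subst i.
have [q Eq Ej] := proj1 (adj_posE d Ep jN) ij.
exists (p.1, q.1); first exact: H Ep Eq.
rewrite Ej; have [_ -> _] := pos_onth n d Ep.
by have [_ -> _] := pos_onth n d Eq.
Qed.

Lemma has_nextE :
  (forall i, i < N -> onth w i = Some SAsm \/ onth w i = Some SHead ->
     exists2 j, j < N & adj w i j) <->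
  forall k p, onth its k = Some p -> p.1 \in [:: SAsm; SHead] -> onth its k.+1.
Proof.
split=> [H k p Ep|H i iN si].
  have [iN Ei _] := pos_onth n d Ep.
  rewrite !inE => ps; have [|j jN /(adj_posE d Ep jN)[q -> //]] := H _ iN.
  by rewrite Ei; case/orP: ps => /eqP ->; [left | right].
have ne : onth w i <> Some Tick by case: si => ->.
have [k [p [Ep Ei]]] := onth_pos iN ne; subst i.
have [_ E1 _] := pos_onth n d Ep; have := H k p Ep.
case Eq: (onth its k.+1) => [q|] H'.
  have [jN _ _] := pos_onth n d Eq; exists (pos n its k.+1) => //.
  by apply/(adj_posE d Ep jN); exists q.
by exfalso; have : false by apply: H'; move: si; rewrite E1 !inE => -[[->]|[->]].
Qed.

Lemma boundedE : 0 < n ->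
  (forall i, i < N -> forall j, j < N ->
     (forall k, k < N -> j <= k) /\ onth w i <> Some Tick -> num w i <= num w j) <->
  all (fun it => it.2 < n) its.
Proof.
(* Position 0 is itself a tick of the leading number, so the ticks after it number [n - 1], and [<=]
   in the formula amounts to a strict bound by [n]. *)
move=> n0; have num0 : (num w 0).+1 = n.
  by case: (n) n0 => // m _; rewrite num_head.
have lt_n v : (v < n) = (v <= num w 0) by lia.
split=> [H|/allP H i iN j jN [j0 ne]].
  apply/allP => it /onthP[k Ek]; have [iN _ Ei] := pos_onth n d Ek.
  rewrite lt_n -Ei; apply: H => //; first by lia.
  by split=> //; apply: (pos_nontick d Ek).
have -> : j = 0 by apply/eqP; rewrite -leqn0 j0 //; lia.
have [k [p [Ep ->]]] := onth_pos iN ne; have [_ _ ->] := pos_onth n d Ep.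
by rewrite -lt_n; apply: H; apply/onthP; exists k.
Qed.

Lemma increasingE s : s != Tick ->
  (forall i, i < N -> forall j, j < N ->
     i < j /\ (onth w i = Some s /\ onth w j = Some s) -> ~ num w j <= num w i) <->
  sorted ltn (vals s its).
Proof.
move=> ne; rewrite sorted_valsE.
split=> [H k l p q kl Ep Eq ps qs|H i iN j jN [ij [Ei Ej]]].
  have [iN Ei Ni] := pos_onth n d Ep; have [jN Ej Nj] := pos_onth n d Eq.
  rewrite ltnNge; apply/negP => le; apply: (H _ iN _ jN); last by rewrite Ni Nj.
  rewrite Ei Ej ps qs; split=> //; apply: ltn_pos.
  by rewrite kl -onthTE Eq.
have [k Ek Ik] := sym_onth d iN ne Ei; have [l El Jl] := sym_onth d jN ne Ej.
apply/negP; rewrite -ltnNge; apply: (H k l _ _ _ Ek El) => //.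
apply: (ltn_pos_inv (n := n) (its := its)); rewrite -?onthTE ?Ek ?El //.
by rewrite -Ik -Jl.
Qed.

Lemma subset_valsE s (P : nat -> Prop) : s != Tick ->
  (forall i, i < N -> onth w i = Some s -> P (num w i)) <->
  forall v, v \in vals s its -> P v.
Proof.
move=> ne; split=> [H v /(ex_symP n d _ ne)[i iN [Es <-]]|H i iN Es].
  exact: H.
by apply: H; apply/(ex_symP n d _ ne); exists i.
Qed.

Lemma Well_formedP : reflect (well_formed n its) (eval Well_formed (fun=> 0)).
Proof.
have H : reflect (
    (exists2 i, i < N & exists2 j, j < N &
     ((forall k, k < N -> i <= k) /\ onth w i = Some Tick) /\
     (adj w i j /\ onth w j = Some SAsm)) /\
    (forall i, i < N -> forall j, j < N -> onth w i <> Some Tick /\ adj w i j ->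
     exists2 st, st \in consecutive & onth w i = Some st.1 /\ onth w j = Some st.2) /\
    (forall i, i < N -> onth w i = Some SAsm \/ onth w i = Some SHead ->
     exists2 j, j < N & adj w i j) /\
    (forall i, i < N -> forall j, j < N ->
     (forall k, k < N -> j <= k) /\ onth w i <> Some Tick -> num w i <= num w j) /\
    (forall i, i < N -> forall j, j < N ->
     i < j /\ (onth w i = Some SAsm /\ onth w j = Some SAsm) ->
     ~ num w j <= num w i) /\
    (forall i, i < N -> forall j, j < N ->
     i < j /\ (onth w i = Some SMember /\ onth w j = Some SMember) ->
     ~ num w j <= num w i) /\
    (forall i, i < N -> onth w i = Some SBody \/ onth w i = Some SMember ->
     num w i \in vals SAsm its) /\
    (forall i, i < N -> onth w i = Some SHead -> exists2 j, j < N &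
     (onth w j = Some SAsm \/ onth w j = Some SContrary) /\ num w i = num w j))
    (eval Well_formed (fun=> 0)).
  rewrite /Well_formed; apply: AndP; first by reflect_eval.
  apply: AndP; last by rewrite /Increasing; reflect_eval.
  apply: AllP => i; apply: AllP => j; apply: ImpP; first by reflect_eval.
  exact: ConsecutiveP.
have headP (v : nat) : (exists2 j, j < N &
     (onth w j = Some SAsm \/ onth w j = Some SContrary) /\ v = num w j) <->
     v \in vals SAsm its ++ vals SContrary its.
  rewrite mem_cat; split=> [[j jN [Ej ->]]|/orP[]/(ex_symP n d)[] // j jN [Ej <-]].
  - by case: Ej => Ej; apply/orP; [left | right]; apply/(ex_symP n d) => //; exists j.
  - by exists j => //; split=> //; left.
  - by exists j => //; split=> //; right.
apply: (iffP H).
  case=> /headE[n0 [v E0]] [/followsE fo [/has_nextE ne [bd [/increasingE ia [/increasingE im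
    [bm he]]]]]].
  split; first split=> //.
    split; first by apply/path_followsE; split=> // p; rewrite E0 => -[<-].
    by apply/(last_finalE _ d); split=> // E; rewrite E onth0n in E0.
  split; first by apply/boundedE.
  split; first by split; [apply: ia | apply: im].
  split; first by apply/(subset_valsE (s := SBody)) => // i iN Ei; apply: bm => //; left.
  split; first by apply/(subset_valsE (s := SMember)) => // i iN Ei; apply: bm => //; right.
  apply/(subset_valsE (s := SHead)
    (fun v => v \in vals SAsm its ++ vals SContrary its)) => // i iN Ei.
  by apply/headP; apply: he.
case=> -[n0 [/path_followsE[f0 fo] /(last_finalE _ d)[le ne]]] [bd [[ia im] [sb [sm sh]]]].
split.
  apply/headE; split=> //; case: (its) f0 le => [_ /(_ erefl) //|[s v] its' f0 _].
  have := f0 _ erefl; rewrite /follows /consecutive !inE /=.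
  by case: (s) => // _; exists v.
split; first exact/followsE.
split; first exact/has_nextE.
split; first exact/boundedE.
split; first exact/increasingE.
split; first exact/increasingE.
split=> [i iN [Ei|Ei]|i iN Ei].
- by apply: sb; apply/(ex_symP n d) => //; exists i.
- by apply: sm; apply/(ex_symP n d) => //; exists i.
by apply/headP/sh/(ex_symP n d) => //; exists i.
Qed.

End Words.

(** * From well-formed words to frameworks *)

Definition mk_items (P Q : seq (nat * nat)) (M : seq nat) : seq (symbol * nat) :=
  flatten [seq [:: (SAsm, p.1); (SContrary, p.2)] | p <- P] ++
  flatten [seq [:: (SHead, q.1); (SBody, q.2)] | q <- Q] ++
  [seq (SMember, m) | m <- M].

Lemma delims_mk P Q M : delims (mk_items P Q M).
Proof. by elim: P => //; elim: Q => //; elim: M. Qed.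

Lemma vals_mk s P Q M : vals s (mk_items P Q M) =
  match s with
  | Tick => [::] | SAsm => unzip1 P | SContrary => unzip2 P
  | SHead => unzip1 Q | SBody => unzip2 Q | SMember => M
  end.
Proof.
elim: P => [|p P]; last by case: s => //= <-.
elim: Q => [|q Q]; last by case: s => //= <-.
by elim: M => [|m M]; case: s => //= IH; rewrite -[in RHS]IH.
Qed.

(** Blocks of two items can be removed together, because the second one starts no pair. *)
Lemma pairs_skip s p q its : q.1 != s ->
  pairs s (p :: q :: its) =
  (if p.1 == s then [:: (p.2, q.2)] else [::]) ++ pairs s its.
Proof. by move=> /negbTE /= ->; case: its. Qed.

Lemma pairs_member s M : s != SMember ->
  pairs s [seq (SMember, m) | m <- M] = [::].
Proof. by case: s => // _; elim: M => [|m [|m' M]]. Qed.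

Lemma pairs_asm P Q M : pairs SAsm (mk_items P Q M) = P.
Proof.
elim: P => [|[a c] P IH].
  by elim: Q => [|q Q IHQ]; [apply: pairs_member | rewrite pairs_skip].
by rewrite -[in RHS]IH pairs_skip.
Qed.

Lemma pairs_head P Q M : pairs SHead (mk_items P Q M) = Q.
Proof.
elim: P => [|p P IH]; last by rewrite pairs_skip.
elim: Q => [|[h b] Q IHQ]; first by apply: pairs_member.
by rewrite -[in RHS]IHQ pairs_skip.
Qed.

(** * Parsing the sequence of delimiters *)

Definition chain s (its : seq (symbol * nat)) :=
  path follows s (unzip1 its) && (last s (unzip1 its) \in final_symbols).

Lemma chain_cons s it its :
  chain s (it :: its) = follows s it.1 && chain it.1 its.
Proof. by rewrite /chain /= andbA. Qed.

Lemma chain_mk p P Q M : chain Tick (mk_items (p :: P) Q M).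
Proof.
have HM s : s \in final_symbols -> chain s (mk_items [::] [::] M).
  elim: M s => [|m M' IH] s sf; first by rewrite /chain /= sf.
  rewrite -[mk_items _ _ _]/((SMember, m) :: mk_items [::] [::] M').
  by rewrite chain_cons IH // andbT; case: (s) sf.
have HQ s : s \in [:: SContrary; SBody] -> chain s (mk_items [::] Q M).
  elim: Q s => [|q Q' IH] s sf; first by apply: HM; case: (s) sf.
  rewrite -[mk_items _ _ _]/[:: (SHead, q.1), (SBody, q.2) & mk_items [::] Q' M].
  by rewrite !chain_cons IH // andbT; case: (s) sf.
rewrite -[mk_items _ _ _]/[:: (SAsm, p.1), (SContrary, p.2) & mk_items P Q M].
rewrite !chain_cons /=; elim: P => [|q P' IH]; first exact: HQ.
rewrite -[mk_items _ _ _]/[:: (SAsm, q.1), (SContrary, q.2) & mk_items P' Q M].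
by rewrite !chain_cons.
Qed.

Lemma chain_member its : chain SMember its -> exists M, its = mk_items [::] [::] M.
Proof.
elim: its => [|[t v] its IH]; first by exists [::].
rewrite chain_cons => /andP[]; case: t => // _ /IH[M ->].
by exists (v :: M).
Qed.

(** From [SBody] the automaton stops, reads another rule, or passes to the members. A rule takes two
    items, hence strong induction on the length. *)
Lemma chain_body its : chain SBody its -> exists Q M, its = mk_items [::] Q M.
Proof.
have [m] := ubnP (size its); elim: m its => // m IH [|[t v] its].
  by exists [::], [::].
rewrite chain_cons ltnS [size _]/= => lt /andP[]; case: t => // _; last first.
  by case/chain_member=> M ->; exists [::], (v :: M).
case: its lt => [|[t b] its] //; rewrite [size _]/= chain_cons => lt /andP[]; case: t => // _.
by case/(IH its (ltnW lt)) => Q [M ->]; exists ((v, b) :: Q), M.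
Qed.

Lemma chain_contrary its : chain SContrary its -> exists P Q M, its = mk_items P Q M.
Proof.
have [m] := ubnP (size its); elim: m its => // m IH [|[t v] its].
  by exists [::], [::], [::].
rewrite chain_cons ltnS [size _]/= => lt /andP[]; case: t => // _; last first.
- by case/chain_member=> M ->; exists [::], [::], (v :: M).
- case: its lt => [|[t b] its] //; rewrite [size _]/= chain_cons => lt /andP[]; case: t => // _.
  by case/chain_body=> Q [M ->]; exists [::], ((v, b) :: Q), M.
case: its lt => [|[t b] its] //; rewrite [size _]/= chain_cons => lt /andP[]; case: t => // _.
by case/(IH its (ltnW lt)) => P [Q [M ->]]; exists ((v, b) :: P), Q, M.
Qed.

Lemma chain_tick its : chain Tick its -> exists p P Q M, its = mk_items (p :: P) Q M.
Proof.
case: its => [|[t v] its] //; rewrite chain_cons => /andP[]; case: t => // _.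
case: its => [|[t b] its] //; rewrite chain_cons => /andP[]; case: t => // _.
by case/chain_contrary=> P [Q [M ->]]; exists (v, b), P, Q, M.
Qed.

(** * Soundness and completeness of repeated marking *)

Section Rounds.

Variables (f : nat -> pred nat -> pred nat) (n : nat).

(** The premise covers arbitrary sets [mk] of correct marks, and thus also the intermediate ones
    within a pass. *)
Lemma rounds_sound (P : nat -> Prop) :
  (forall k (mk : pred nat) i, i < n -> (forall j, mk j -> P j) -> f k mk i -> P i) ->
  forall k i, rounds f n k i -> P i.
Proof.
move=> H; elim=> [//|k IH] /=; suff: forall m, m <= n -> forall i,
  mark_pass (f k) (rounds f n k) m i -> P i by apply.
elim=> [_|m IHm lt i /=]; first exact: IH.
case/orP=> [/andP[fm /eqP ->]|]; last by apply: IHm; apply: ltnW.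
by apply: H fm => //; apply: IHm; apply: ltnW.
Qed.

Lemma mark_pass_sub (g : pred nat -> pred nat) (mk : pred nat) m i :
  mk i -> mark_pass g mk m i.
Proof. by move=> mi; elim: m => //= m ->; rewrite orbT. Qed.

Lemma mark_pass_at (g : pred nat -> pred nat) (mk : pred nat) m i : i < m ->
  (forall mk' : pred nat, (forall j, mk j -> mk' j) -> g mk' i) ->
  mark_pass g mk m i.
Proof.
move=> lt H; elim: m lt => // m IH; rewrite ltnS leq_eqVlt /= => /predU1P[<-|/IH ->].
  by rewrite eqxx andbT H // => j; apply: mark_pass_sub.
by rewrite orbT.
Qed.

(** [Q r i] gives position [i] rank [r], and rank [r] is marked within [r.+1] rounds. The test is
    required to succeed on every [mk] containing the lower ranks, so additional marks do no harm. *)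
Lemma rounds_complete (Q : nat -> nat -> Prop) :
  (forall r i, Q r i -> i < n) ->
  (forall k (mk : pred nat) i r, Q r i -> (forall j r', r' < r -> Q r' j -> mk j) -> f k mk i) ->
  forall k i r, Q r i -> r < k -> rounds f n k i.
Proof.
move=> Qn H; elim=> [//|k IH] i r Qi lt /=.
apply: mark_pass_at => [|mk' sub]; first exact: Qn Qi.
by apply: H Qi _ => j r' lt' Qj; apply/sub/(IH j r') => //; lia.
Qed.

End Rounds.

(** [encode] lists assumptions through the subtype on which contraries are defined; this identifies
    its order with that of the set. *)
Lemma val_enum_sub (T : finType) (A : {set T}) :
  [seq val x | x <- enum {: {x : T | x \in A}}] = enum A.
Proof.
have -> : enum {: {x : T | x \in A}} = pmap insub (Finite.enum T).
  transitivity (isFinite.enum_subdef (Finite.class {x : T | x \in A})) => //.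
  by rewrite enumT !unlock.
rewrite (pmap_filter (insubK _)).
by apply: eq_filter => x; rewrite isSome_insub.
Qed.

Definition rk (T : finType) (x : T) : nat := enum_rank x.

Lemma rk_inj (T : finType) : injective (@rk T).
Proof. by move=> x y /val_inj/enum_rank_inj. Qed.

Lemma rk_lt (T : finType) (x : T) : rk x < #|T|.
Proof. exact: ltn_ord. Qed.

Lemma rk_surj (T : finType) v : v < #|T| -> exists x : T, v = rk x.
Proof. by move=> lt; exists (enum_val (Ordinal lt)); rewrite /rk enum_valK. Qed.

Lemma sorted_rk_enum (T : finType) (A : {set T}) :
  sorted ltn [seq rk x | x <- enum A].
Proof.
have -> : enum A = filter (mem A) (enum T) by rewrite enumT.
rewrite sorted_map; apply: sorted_filter; first by move=> x y z; apply: ltn_trans.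
rewrite -sorted_map; suff -> : map (@rk T) (enum T) = iota 0 #|T|.
  exact: iota_ltn_sorted.
apply: (@eq_from_nth _ 0) => [|i]; first by rewrite size_map size_iota -cardE.
rewrite size_map -cardE => lt; rewrite nth_iota // add0n.
have x0 := enum_val (Ordinal lt).
rewrite (nth_map x0) -?cardE // -[i]/(nat_of_ord (Ordinal lt)) -enum_val_nth.
by rewrite /rk enum_valK.
Qed.

(** * The formulas evaluated on the encoding of a framework *)

Section Encoding.

Variables (L : finType) (F : aba L) (A : {set L}).
Hypothesis bip : bipolar F.
Hypothesis AF : A \subset asm F.

Definition asm_list : seq (nat * nat) :=
  [seq (rk (val a), rk (contrary a)) | a <- enum {: {x : L | x \in asm F}}].
(** For a bipolar rule, [head r.1 r.2] is the single body element; [r.1] just provides a default of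
    the right type. *)
Definition rule_list : seq (nat * nat) :=
  [seq (rk r.1, rk (head r.1 r.2)) | r <- rules F].
Definition items := mk_items asm_list rule_list [seq rk a | a <- enum A].

Lemma rule_singleton r : r \in rules F -> r.2 = [:: head r.1 r.2].
Proof. by case/bip => a _ [-> _]. Qed.

Lemma encodeE : encode F A = enc_items #|L| items.
Proof.
rewrite enc_itemsE /items /mk_items !map_cat !flatten_cat.
congr (_ ++ (_ ++ (_ ++ _))).
- by rewrite /asm_list; elim: (enum _) => //= a l ->; rewrite -catA.
- rewrite /rule_list; have := rule_singleton.
  elim: (rules F) => //= r l IH H; rewrite IH => [|r' r'l]; last first.
    by apply: H; rewrite inE r'l orbT.
  rewrite /encode_rule {1}(H r) ?inE ?eqxx //= cats0 /encode_item.
  by rewrite -catA.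
- by elim: (enum A) => //= a l ->.
Qed.

Lemma mem_vals_member x : (rk x \in vals SMember items) = (x \in A).
Proof. by rewrite vals_mk mem_map ?mem_enum //; apply: rk_inj. Qed.

Lemma unzip1_asm_list : unzip1 asm_list = [seq rk x | x <- enum (asm F)].
Proof. by rewrite -val_enum_sub /unzip1 -!map_comp. Qed.

Lemma mem_vals_asm x : (rk x \in vals SAsm items) = (x \in asm F).
Proof. by rewrite vals_mk unzip1_asm_list mem_map ?mem_enum //; apply: rk_inj. Qed.

Lemma mem_pairs_asm a c :
  ((rk a, rk c) \in pairs SAsm items) = has_contrary F a c.
Proof.
rewrite pairs_asm; apply/mapP/existsP => [[b _ [/rk_inj -> /rk_inj ->]]|].
  by exists b; rewrite !eqxx.
by case=> b /andP[/eqP <- /eqP <-]; exists b; rewrite ?mem_enum.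
Qed.

Lemma mem_pairs_head h b :
  ((rk h, rk b) \in pairs SHead items) = step_rel F b h.
Proof.
rewrite pairs_head /step_rel; apply/mapP/idP => [[r rF [/rk_inj -> /rk_inj ->]]|H].
  by rewrite -rule_singleton // -surjective_pairing.
by exists (h, [:: b]).
Qed.

Lemma vals_items_lt s v : v \in vals s items -> v < #|L|.
Proof.
rewrite vals_mk; case: s => //.
- by case/mapP=> -[a c] /mapP[b _ [-> _]] ->; apply: rk_lt.
- by case/mapP=> -[a c] /mapP[b _ [_ ->]] ->; apply: rk_lt.
- by case/mapP=> -[a c] /mapP[b _ [-> _]] ->; apply: rk_lt.
- by case/mapP=> -[a c] /mapP[b _ [_ ->]] ->; apply: rk_lt.
- by case/mapP=> a _ ->; apply: rk_lt.
Qed.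

Lemma vals_rk s v : v \in vals s items -> exists x : L, v = rk x.
Proof. by move=> /vals_items_lt/rk_surj. Qed.

Lemma pairs_rk s v u : (v, u) \in pairs s items ->
  exists x y : L, v = rk x /\ u = rk y.
Proof.
case/mem_pairs=> k [t [E1 E2]].
have [|x ->] := @vals_rk s v; first by rewrite mem_vals; apply/onthP; exists k.
have [|y ->] := @vals_rk t u; first by rewrite mem_vals; apply/onthP; exists k.+1.
by exists x, y.
Qed.

Lemma well_formed_items : well_formed #|L| items.
Proof.
have [a0 a0F] := set0Pn _ (asm_neq0 F).
split; [|split; [|split; [split|split; [|split]]]].
- split; first by apply/card_gt0P; exists a0.
  suff : chain Tick items by case/andP.
  rewrite /items; case El: asm_list => [|p P]; last exact: chain_mk.
  have := mem_vals_asm a0; rewrite vals_mk.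
  by rewrite /unzip1 El /= a0F.
- apply/allP => -[s v] sv; apply: (@vals_items_lt s); by rewrite mem_vals.
- by rewrite vals_mk unzip1_asm_list; apply: sorted_rk_enum.
- by rewrite vals_mk; apply: sorted_rk_enum.
- move=> v; rewrite vals_mk => /mapP[q /mapP[r rF ->] ->] /=.
  rewrite mem_vals_asm; have [a aF [-> _]] := bip rF; exact: aF.
- move=> v vM; have [x Ex] := vals_rk vM; move: vM.
  by rewrite Ex mem_vals_member mem_vals_asm; apply: (subsetP AF).
- move=> v; rewrite vals_mk => /mapP[q /mapP[r rF ->] ->] /=.
  rewrite mem_cat mem_vals_asm; have [_ _ [_ [->//|[b ->]]]] := bip rF.
  apply/orP; right; rewrite vals_mk; apply/mapP.
  by exists (rk (val b), rk (contrary b)) => //; apply: map_f; rewrite mem_enum.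
Qed.

Lemma directNE c : directN items (rk c) <-> direct F A c.
Proof.
rewrite /directN mem_vals_member; split=> [[cA|[v cv vA]]|/orP[|/existsP[b]]].
- by rewrite /direct cA.
- have [x Ex] := vals_rk vA; move: cv vA; rewrite Ex mem_pairs_head mem_vals_member.
  by move=> st xA; apply/orP; right; apply/existsP; exists x; rewrite xA.
- by left.
- by case/andP=> bA st; right; exists (rk b); rewrite ?mem_pairs_head ?mem_vals_member.
Qed.

Lemma attackedNE x : attackedN items (rk x) <-> attacked F A x.
Proof.
split=> [[v xv dv]|/existsP[c /andP[xc dc]]]; last first.
  by exists (rk c); rewrite ?mem_pairs_asm //; apply/directNE.
have [_ [c [_ Ec]]] := pairs_rk xv; move: xv dv.
rewrite Ec mem_pairs_asm => xc /directNE dc; apply/existsP; exists c.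
by rewrite xc.
Qed.

Lemma ClosedE :
  (forall h b, (h, b) \in pairs SHead items -> b \in vals SMember items ->
     h \in vals SAsm items -> h \in vals SMember items) <->
  step_closed F A.
Proof.
split=> [H b h bA hF st|H v u vu].
  by rewrite -mem_vals_member; apply: (H _ (rk b));
    rewrite ?mem_pairs_head ?mem_vals_member ?mem_vals_asm.
have [h [b [Eh Eb]]] := pairs_rk vu; move: vu.
rewrite Eh Eb mem_pairs_head !mem_vals_member mem_vals_asm => st bA hF.
exact: H st.
Qed.

Lemma Conflict_freeE :
  (forall a c, (a, c) \in pairs SAsm items -> a \in vals SMember items ->
     ~ directN items c) <->
  forall a c, has_contrary F a c -> a \in A -> ~~ direct F A c.
Proof.
split=> [H a c ac aA|H v u vu].
  apply/negP => /directNE; apply: H (_ : (rk a, _) \in _) _.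
    by rewrite mem_pairs_asm.
  by rewrite mem_vals_member.
have [a [c [Ea Ec]]] := pairs_rk vu; move: vu.
rewrite Ea Ec mem_pairs_asm mem_vals_member => ac aA /directNE.
exact/negP/(H a).
Qed.

Notation w := (enc_items #|L| items).
Notation N := (size w).

Lemma delims_items : delims items. Proof. exact: delims_mk. Qed.

Lemma asm_position i : i < N -> onth w i = Some SAsm ->
  exists2 x : L, x \in asm F & num w i = rk x.
Proof.
move=> iN Ei; have iv : num w i \in vals SAsm items.
  by apply/(ex_symP #|L| delims_items) => //; exists i.
by have [x Ex] := vals_rk iv; exists x; rewrite // -mem_vals_asm -Ex.
Qed.

Lemma rounds_counteredE i x : i < N -> onth w i = Some SAsm -> num w i = rk x ->
  rounds (step_eval w v0 v1 Step) N N i <-> countered F A x.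
Proof.
move=> iN Ei Ex; split=> [Hi|].
  pose P i := exists2 x, num w i = rk x & countered F A x.
  suff : P i by case=> y; rewrite Ex => /rk_inj ->.
  apply: (rounds_sound _ Hi) => {Hi Ex x Ei iN}k mk {}i iN IH.
  case/(StepP #|L| delims_items) => Ei Hi; have [x xF Ex] := asm_position iN Ei.
  exists x => //; case: Hi => [|[h [hi [z zN [Ez Eh /IH[y Ey cy]]]]]].
    rewrite Ex => /attackedNE ax.
    by apply/existsP; exists x; rewrite ax connect0.
  have yF : y \in asm F.
    by have [y' y'F] := asm_position zN Ez; rewrite Ey => /rk_inj ->.
  move: hi; rewrite -Eh Ey Ex mem_pairs_head => st.
  case/existsP: cy => t /andP[at_ yt]; apply/existsP; exists t; rewrite at_ /=.
  by apply: connect_trans (connect1 _) yt; rewrite /asm_step st.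
case/existsP=> y /andP[ay /connectP[p0 pp0 Ey0]].
(* The path is shortened to one without repetition, so that its length is below [#|L|]. *)
have [p [pp up Ey]] : exists p, [/\ path (asm_step F) x p, uniq (x :: p) & y = last x p].
  by move: Ey0; case/shortenP: pp0 => p pp up _ ->; exists p.
(* The rank of an assumption is the length of a path from it to an attacked assumption. *)
pose Q r i := [/\ i < N, onth w i = Some SAsm & exists x p,
  [/\ num w i = rk x, path (asm_step F) x p, attacked F A (last x p) & size p = r]].
have Qi : Q (size p) i by split=> //; exists x, p; rewrite -Ey.
apply: (rounds_complete _ _ Qi) => [r j []//||]; last first.
  (* Enough rounds are made: the path has at most [#|L|] vertices, and the word begins with [#|L|]
     ticks. *)
  rewrite -[X in X <= _]/(size (x :: p)) -(card_uniqP up).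
  by apply: leq_trans (max_card _) _; rewrite enc_itemsE size_cat size_nseq leq_addr.
move=> k mk j r [jN Ej [z [q [Ez pq aq Er]]]] IH.
apply/(StepP #|L| delims_items); split=> //; rewrite Ez.
case: q pq aq Er => [|h q] /= => [_ /attackedNE az _|/andP[/andP[st hF] pq] aq Er].
  by left.
right; exists (rk h); rewrite mem_pairs_head; split=> //.
have /(ex_symP #|L| delims_items)[//|l lN [El Eh]] : rk h \in vals SAsm items.
  by rewrite mem_vals_asm.
exists l => //; split=> //; apply: (IH l (size q)); first by rewrite -Er.
by split=> //; exists h, q.
Qed.

Lemma DefendedE :
  (forall i, i < N -> onth w i = Some SAsm ->
     ~ rounds (step_eval w v0 v1 Step) N N i ->
     forall a c, (a, c) \in pairs SAsm items -> a \in vals SMember items ->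
       c <> num w i /\ (c, num w i) \notin pairs SHead items) <->
  forall x a c, x \in asm F -> ~~ countered F A x -> has_contrary F a c ->
    a \in A -> c <> x /\ ~~ step_rel F x c.
Proof.
split=> [H x a c xF nx ac aA|H i iN Ei ni v u vu vA].
  have /(ex_symP #|L| delims_items)[//|i iN [Ei Ex]] : rk x \in vals SAsm items.
    by rewrite mem_vals_asm.
  have [|||ne ns] := H i iN Ei _ (rk a) (rk c).
  - by move/(rounds_counteredE iN Ei Ex); apply/negP.
  - by rewrite mem_pairs_asm.
  - by rewrite mem_vals_member.
  rewrite Ex in ne ns; rewrite -mem_pairs_head; split=> // E.
  by rewrite E in ne.
have [x xF Ex] := asm_position iN Ei.
have [a [c [Ea Ec]]] := pairs_rk vu; move: vu vA.
rewrite Ea Ec Ex mem_pairs_asm mem_vals_member mem_pairs_head => ac aA.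
have nx : ~~ countered F A x.
  by apply/negP => cx; apply: ni; apply/(rounds_counteredE iN Ei Ex).
by have [ne ns] := H x a c xF nx ac aA; split=> // /rk_inj.
Qed.

Lemma formulas_admissible : admissible F A <->
  eval w pred0 (And Well_formed (And Closed_A Conflict_free_A)) (fun=> 0) /\
  eval w (rounds (step_eval w v0 v1 Step) N N) Defended (fun=> 0).
Proof.
have gP := AndP (Well_formedP #|L| pred0 delims_items)
  (AndP (Closed_AP #|L| delims_items pred0) (Conflict_free_AP #|L| delims_items pred0)).
rewrite (admissibleE bip AF); split.
  case=> /ClosedE H1 /Conflict_freeE H2 H3; split.
    by apply/gP; split; first exact: well_formed_items.
  exact/(DefendedP #|L| delims_items _)/DefendedE.
case=> /gP[_ [/ClosedE H1 /Conflict_freeE H2]].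
by move=> /(DefendedP #|L| delims_items _)/DefendedE H3.
Qed.

End Encoding.

(** * Decoding well-formed words *)

Definition assoc (P : seq (nat * nat)) (v : nat) :=
  nth 0 (unzip2 P) (index v (unzip1 P)).

Lemma map_assoc P : uniq (unzip1 P) -> [seq (v, assoc P v) | v <- unzip1 P] = P.
Proof.
move=> up; have sz : size (unzip1 P) = size P by rewrite size_map.
apply: (@eq_from_nth _ (0, 0)) => [|i]; rewrite size_map sz // => lt.
rewrite (nth_map 0) ?sz // /assoc index_uniq ?sz //.
by rewrite !(nth_map (0, 0)) // -surjective_pairing.
Qed.

Lemma rk_ord n (i : 'I_n) : rk i = i.
Proof. by rewrite /rk enum_rank_ord. Qed.

(** Ordinals serve as sentences because their ranks are their values. A strictly increasing list is
    determined by its elements, so the assumptions and members are recovered in order; strict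
    increase also excludes repeated assumptions, so the listed contraries form the graph of a
    function. *)
Lemma well_formed_encode n its : well_formed n its ->
  exists (L : finType) (F : aba L) (A : {set L}),
    [/\ bipolar F, A \subset asm F & encode F A = enc_items n its].
Proof.
case=> -[n0 [pf lf]] [bd [[sa sm] [sb [ms sh]]]].
have {pf lf} [p0 [P0 [Q [M Eits]]]] := chain_tick (introT andP (conj pf lf)).
move Ep: (p0 :: P0) Eits => P Eits; subst its.
(* The type has to be of the form ['I_n.+1] for [inord]. *)
case: n n0 bd => // n _ bd.
have lt_n s v : v \in vals s (mk_items P Q M) -> v < n.+1.
  by rewrite mem_vals => /(allP bd).
move: sa sm sb ms sh; rewrite !vals_mk => sa sm sb ms sh.
have lt_a v : v \in unzip1 P -> v < n.+1 by have := lt_n SAsm v; rewrite vals_mk.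
have lt_c v : v \in unzip2 P -> v < n.+1 by have := lt_n SContrary v; rewrite vals_mk.
have lt_h v : v \in unzip1 Q -> v < n.+1 by have := lt_n SHead v; rewrite vals_mk.
have lt_b v : v \in unzip2 Q -> v < n.+1 by have := lt_n SBody v; rewrite vals_mk.
have lt_m v : v \in M -> v < n.+1 by have := lt_n SMember v; rewrite vals_mk.
have graph := map_assoc (sorted_uniq ltn_trans ltnn sa).
have lt_g v : v \in unzip1 P -> assoc P v < n.+1.
  move=> vP; apply/lt_c/mem_nth; rewrite !size_map -(size_map fst P).
  by rewrite index_mem.
pose as_set := [set i : 'I_n.+1 | (i : nat) \in unzip1 P].
have as_neq0 : as_set != set0.
  have p0P : p0.1 \in unzip1 P by rewrite -Ep inE eqxx.
  by apply/set0Pn; exists (inord p0.1); rewrite inE inordK // lt_a.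
pose F := @ABA 'I_n.+1 [seq (inord q.1, [:: inord q.2]) | q <- Q] as_set as_neq0
  (fun x => inord (assoc P (val x))).
pose A := [set i : 'I_n.+1 | (i : nat) \in M].
have as_in v : v \in unzip1 P -> (inord v : 'I_n.+1) \in as_set.
  by move=> vP; rewrite inE inordK // lt_a.
have bip : bipolar F.
  move=> r /mapP[q qQ ->] /=; exists (inord q.2).
    by apply/as_in/sb/map_f.
  split=> //; have : q.1 \in unzip1 P ++ unzip2 P by apply/sh/map_f.
  rewrite mem_cat => /orP[/as_in|/mapP[p pP ->]]; first by left.
  right; have p1 : p.1 \in unzip1 P by apply: map_f.
  exists (exist _ (inord p.1) (as_in _ p1)) => /=; congr inord.
  have : p \in [seq (v, assoc P v) | v <- unzip1 P] by rewrite graph.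
  by rewrite inordK ?lt_a // => /mapP[v _ ->].
exists 'I_n.+1, F, A; split=> //.
  by apply/subsetP => i; rewrite !inE; apply: ms.
have EA : [seq rk a | a <- enum A] = M.
  apply: (irr_sorted_eq ltn_trans ltnn) (sorted_rk_enum A) sm _ => v.
  apply/mapP/idP => [[i]|vM]; first by rewrite mem_enum inE => iM ->; rewrite rk_ord.
  by exists (inord v); rewrite ?mem_enum ?inE ?rk_ord inordK ?lt_m.
have EP : asm_list F = P.
  have E1 : unzip1 (asm_list F) = unzip1 P.
    rewrite unzip1_asm_list.
    apply: (irr_sorted_eq ltn_trans ltnn) (sorted_rk_enum _) sa _ => v.
    apply/mapP/idP => [[i]|vP]; first by rewrite mem_enum inE => iP ->; rewrite rk_ord.
    by exists (inord v); rewrite ?mem_enum ?as_in ?rk_ord ?inordK ?lt_a.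
  rewrite -[RHS]graph -E1 /unzip1 -map_comp.
  rewrite -[LHS]map_id; apply/eq_in_map => q /mapP[a _ ->] /=.
  by rewrite !rk_ord inordK // lt_g //; have := valP a; rewrite inE.
have EQ : rule_list F = Q.
  rewrite /rule_list /= -map_comp -[RHS]map_id; apply/eq_in_map => -[h b] qQ /=.
  rewrite !rk_ord; congr (_, _); apply: inordK; [apply: lt_h | apply: lt_b].
    by apply/mapP; exists (h, b).
  by apply/mapP; exists (h, b).
by rewrite (encodeE A bip) /items EA EP EQ card_ord.
Qed.

Theorem proposition3p6 : in_P bipolar_verification_admissible.
Proof.
apply: (in_P_formula (x := v0) (y := v1) (p := Step) (q := Defended)
  (g := And Well_formed (And Closed_A Conflict_free_A))) => //.
  (* The empty word encodes nothing: assumptions exist, so an encoding starts with at least one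
     tick. *)
  case=> L [F [A [bip AF]]]; rewrite (encodeE A bip) enc_itemsE => E _.
  have /set0Pn[x _] := asm_neq0 F; have : 0 < #|L| by apply/card_gt0P; exists x.
  by case: #|L| E.
move=> w _; split=> [[L [F [A [bip AF -> adm]]]]|H].
  by rewrite (encodeE A bip); apply/formulas_admissible.
have [n [its [d Ew]]] := enc_items_surj w; subst w.
(* Well-formedness supplies a framework encoded by the word, and only then can the formulas be read
   as statements about admissibility. *)
have wf : well_formed n its by case: H => /andP[/(Well_formedP n pred0 d)].
have [L [F [A [bip AF E]]]] := well_formed_encode wf.
exists L, F, A; split=> //; apply/formulas_admissible => //.
by rewrite -(encodeE A bip) E.
Qed.
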